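(* Let $H\in\mathcal H_\star(N-1)$ be an optimal vertex algorithm. Then $H^{\mathsf A}\in\mathcal H_\star(N-1)$ if and only if the arc diagram $\mathcal G(H)$ is non-crossing. Additionally, when this is the case, $H^{\mathsf A}$ is also a vertex algorithm with, for $1\le j<i\le N$, $$\lambda^\star_{N-j+1,N-i+1}(H^{\mathsf A})=\begin{cases}\dfrac{1}{\lambda^\star_{k(i-1),i-1}(H)} & \text{if } j=\ell(i-1),\\[2mm] 0 & \text{otherwise.}\end{cases}$$
   Context: Algorithms. Let $N\ge 1$ be an integer. An H-matrix of size $N-1$ is a real lower triangular matrix $H=(h_{k,j})_{1\le j\le k\le N-1}$ (empty for $N=1$). Given a real Hilbert space $\mathcal X$, an operator $T:\mathcal X\to\mathcal X$ and $y_0\in\mathcal X$, the algorithm defined by $H$ generates $y_{k+1}=y_k-\sum_{j=0}^{k}h_{k+1,j+1}(y_j-Ty_j)$ for $k=0,\dots,N-2$. $T$ is nonexpansive if $\|Tx-Ty\|\le\|x-y\|$ for all $x,y\in\mathcal X$; $y_\star$ is a fixed point if $Ty_\star=y_\star$. $\mathcal H_\star(N-1)$ is the set of H-matrices of size $N-1$ such that $\|y_{N-1}-Ty_{N-1}\|^2\le 4\|y_0-y_\star\|^2/N^2$ for every real Hilbert space $\mathcal X$, every nonexpansive $T:\mathcal X\to\mathcal X$ with a fixed point $y_\star$ and every $y_0\in\mathcal X$. The H-dual of $H$ is the anti-diagonal transpose $H^{\mathsf A}$ with $(H^{\mathsf A})_{k,j}=h_{N-j,N-k}$, $1\le j\le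 k\le N-1$. H-certificates. For $m,j\in\{1,\dots,N-1\}$ let $Q(m,j;H)=\sum\prod_{r=1}^m h_{i(r),j(r)}$, the sum over all integers $j=j(1)\le i(1)<j(2)\le i(2)<\cdots<j(m)\le i(m)\le N-1$ (an empty sum is $0$). The H-certificates of $H$ are $\lambda^\star_{N,j}(H)=N\sum_{m=1}^{N-1}(-1)^{m-1}Q(m,j;H)$ for $1\le j\le N-1$, and $\lambda^\star_{k,j}(H)=N\sum_{\ell=1}^{N-1}\sum_{m=1}^{N-1}(-1)^{\ell+m-1}\binom{\ell+m}{m}Q(\ell,j;H)Q(m,k;H)$ for $1\le j<k\le N-1$. Known fact (Yoon–Ryu–Grimmer): $H\in\mathcal H_\star(N-1)$ if and only if $\sum_{j=1}^{N-1}Q(k,j;H)=\frac1N\binom{N}{k+1}$ for $k=1,\dots,N-1$ and $\lambda^\star_{k,j}(H)\ge 0$ for all $1\le j<k\le N$. Vertices and arc diagrams. An optimal vertex algorithm (vertex of $\mathcal H_\star(N-1)$) is an $H\in\mathcal H_\star(N-1)$ such that for each $j=1,\dots,N-1$ there is exactly one index $k(j)\in\{j+1,\dots,N\}$ with $\lambda^\star_{k(j),j}(H)>0$. Its arc diagram $\mathcal G(H)$ is the graph on nodes $\{1,\dots,N\}$ with edges (arcs) $(k(j),j)$, $j=1,\dots,N-1$. It is non-crossing (in the paper also called basic) if there is no pair $(j_1,j_2)$ with $j_1<j_2<k(j_1)<k(j_2)$. For a node $j$, $\mathcal C(j)=\{j,k(j),k(k(j)),\dots,N\}$ denotes the unique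 increasing path from $j$ to $N$, and $\ell(v)=\min\{j: v\in\mathcal C(j)\}$ is the smallest descendant of $v$. *)

(* Defs.v *)
From HB Require Import structures.
From mathcomp Require Import all_boot all_order all_algebra sesquilinear.
From mathcomp Require Import all_classical all_reals all_analysis.

Set Implicit Arguments.
Unset Strict Implicit.
Unset Printing Implicit Defensive.

Import Order.TTheory GRing.Theory Num.Theory.
Import numFieldNormedType.Exports.

Local Open Scope ring_scope.

(* Throughout, an H-matrix of size N-1 is a matrix H : 'M[R]_N.-1 such that
   is_trig_mx H (lower triangular). Its entry h_{k+1,j+1} is H k j, since
   ordinals start at 0. The nodes 1, ..., N of the arc diagram, and the indices
   of the H-certificates, are natural numbers and are NOT shifted. *)

(* A real Hilbert space is a complete normed space whose norm comes from a
   positive definite symmetric bilinear form. *)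
Definition hilbert_dot (R : realType) (X : completeNormedModType R)
    (dot : {dot X for (@idfun R)}) : Prop :=
  forall x : X, dot x x = `|x| ^+ 2.

Definition nonexpansive (R : realType) (X : normedModType R) (T : X -> X) :
    Prop :=
  forall x y : X, `|T x - T y| <= `|x - y|.

(* Only the values y 0, ..., y N.-1 are constrained. *)
Definition generates (R : realType) (N : nat) (H : 'M[R]_N.-1)
    (X : normedModType R) (T : X -> X) (y : nat -> X) : Prop :=
  forall k : 'I_N.-1,
    y k.+1 = y k - \sum_(j < N.-1 | (j <= k)%N) H k j *: (y j - T (y j)).

Definition Hstar (R : realType) (N : nat) (H : 'M[R]_N.-1) : Prop :=
  is_trig_mx H /\
  forall (X : completeNormedModType R) (dot : {dot X for (@idfun R)}),
    hilbert_dot dot ->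
  forall (T : X -> X) (ystar : X) (y : nat -> X),
    nonexpansive T -> T ystar = ystar -> generates H T y ->
    `|y N.-1 - T (y N.-1)| ^+ 2 <= 4 * `|y 0%N - ystar| ^+ 2 / N%:R ^+ 2.

Definition Hdual (R : realType) (N : nat) (H : 'M[R]_N.-1) : 'M[R]_N.-1 :=
  \matrix_(k < N.-1, j < N.-1) H (rev_ord j) (rev_ord k).

(* I r and J r are i(r+1) - 1 and j(r+1) - 1. *)
Definition chain (n m j : nat) (I J : {ffun 'I_m -> 'I_n}) : bool :=
  [&& [forall r : 'I_m, (r == 0 :> nat)%N ==> ((J r).+1 == j)],
      [forall r : 'I_m, J r <= I r]%N &
      [forall r : 'I_m, forall s : 'I_m, (r.+1 == s) ==> (I r < J s)]%N].

(* Meaningful for m >= 1 only. *)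
Definition Q (R : realType) (n : nat) (H : 'M[R]_n) (m j : nat) : R :=
  \sum_(IJ : {ffun 'I_m -> 'I_n} * {ffun 'I_m -> 'I_n} | chain j IJ.1 IJ.2)
    \prod_(r < m) H (IJ.1 r) (IJ.2 r).

(* lambda^star_{k,j}(H), for 1 <= j < k <= N *)
Definition Hcert (R : realType) (N : nat) (H : 'M[R]_N.-1) (k j : nat) : R :=
  if k == N then
    N%:R * \sum_(1 <= m < N) (-1) ^+ m.-1 * Q H m j
  else
    N%:R * \sum_(1 <= l < N) \sum_(1 <= m < N)
      (-1) ^+ (l + m).-1 * ('C(l + m, m))%:R * Q H l j * Q H m k.

Definition optimal_vertex (R : realType) (N : nat) (H : 'M[R]_N.-1) : Prop :=
  Hstar H /\
  forall j : nat, (1 <= j < N)%N ->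
    exists! k : nat, (j < k <= N)%N /\ 0 < Hcert H k j.

(* k(j): the least k in {j+1, ..., N} with a positive certificate, which is the
   only one when H is an optimal vertex; in addition parent H N = N. *)
Definition parent (R : realType) (N : nat) (H : 'M[R]_N.-1) (j : nat) : nat :=
  head N [seq k <- index_iota j.+1 N.+1 | 0 < Hcert H k j].

Definition arc_diagram (R : realType) (N : nat) (H : 'M[R]_N.-1) :
    seq (nat * nat) :=
  [seq (parent H j, j) | j <- index_iota 1 N].

Definition noncrossing (G : seq (nat * nat)) : Prop :=
  ~ exists a b : nat * nat,
      [/\ a \in G, b \in G & (a.2 < b.2 < a.1)%N && (a.1 < b.1)%N].

(* C(j), for 1 <= j <= N; the sequence stays at N once it has reached it. *)
Definition path_to_top (R : realType) (N : nat) (H : 'M[R]_N.-1) (j : nat) :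
    seq nat :=
  traject (parent H) j N.

(* The default value v of the minimum is harmless because v is in C(v). *)
Definition smallest_descendant (R : realType) (N : nat) (H : 'M[R]_N.-1)
    (v : nat) : nat :=
  \big[minn/v]_(1 <= j < N.+1 | v \in path_to_top H j) j.

(* Main.v *)
(* Let C be the matrix for which the iterates satisfy x_k = x_1 - \sum_j C_kj g_j,
   with g_j = x_j - T x_j, let q_m be the last row of C^m, and attach to every
   node j the polynomial phi_j(z) = \sum_m (z - 1)^m q_m(j).  The H-certificate
   lambda_kj is - N <phi_k, phi_j> for the coefficient inner product.  Since
   multiplication by z is an isometry, the Gram matrix Gamma of the phi_j solves
   Gamma + Gamma C + C^T Gamma = e_N e_N^T, and it has row sums e_N / N exactly
   when H satisfies the H-invariance conditions.

   Optimality is equivalent to these conditions together with lambda >= 0.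
   Sufficiency is the weighted sum of the nonexpansiveness inequalities given by
   the equation for Gamma.  For necessity, take T to be the negacyclic shift M of
   R^N started at (1, ..., 1) / 2: it forces g_N = (1, ..., 1) / N, which gives
   the invariance conditions.  Composing M with the reflection of a half-space
   that barely contains the single iterate x_k makes only the inequality between
   x_k and x_j strict to first order, so that lambda_kj >= 0.

   The matrix of the dual polynomials is obtained by differencing rows and
   columns of the solution P of P + C P + P C^T = 1 1^T, whence
   P = (N^2 Gamma)^{-1}.  At a vertex N Gamma is the Laplacian of a rooted tree,
   and N P has the entries \sum 1 / lambda_v over the common ancestors v of two
   nodes.  When the arcs do not cross, the descendants of v form an interval and
   the differencing leaves one term per node; a crossing produces a rectangle on
   which the differences have a positive sum, hence a negative certificate. *)
Require Import Defs.
From HB Require Import structures.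
From mathcomp Require Import all_boot all_order all_algebra sesquilinear.
From mathcomp Require Import all_classical all_reals all_analysis.
From mathcomp Require Import ring lra zify.

Set Implicit Arguments.
Unset Strict Implicit.
Unset Printing Implicit Defensive.

Import Order.TTheory GRing.Theory Num.Theory.
Import numFieldNormedType.Exports.

Local Open Scope ring_scope.

(** * Euclidean space as a Hilbert space *)

Definition euclid (R : realType) (n : nat) : Type := 'rV[R]_n.

HB.instance Definition _ (R : realType) (n : nat) :=
  GRing.Lmodule.copy (euclid R n) 'rV[R]_n.

Section Euclid.
Variables (R : realType) (n : nat).
Local Notation E := (euclid R n).
Implicit Types u v w : E.

Definition coor u (i : 'I_n) : R := (u : 'rV[R]_n) ord0 i.

Definition edot u v : R := \sum_i coor u i * coor v i.

Lemma coorD u v i : coor (u + v) i = coor u i + coor v i.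
Proof. by rewrite /coor mxE. Qed.

Lemma coorZ a u i : coor (a *: u) i = a * coor u i.
Proof. by rewrite /coor mxE. Qed.

Lemma coorB u v i : coor (u - v) i = coor u i - coor v i.
Proof. by rewrite /coor !mxE. Qed.

Lemma edotC u v : edot u v = edot v u.
Proof. by apply: eq_bigr => i _; rewrite mulrC. Qed.

Lemma edot_linear v : GRing.linear_for *%R (edot v).
Proof.
move=> a u w; rewrite /edot mulr_sumr -big_split/=.
by apply: eq_bigr => i _; rewrite coorD coorZ mulrDr mulrCA.
Qed.

Lemma edot_bilinear : bilinear_for *%R (@idfun R \; *%R) edot.
Proof.
split=> v a u w; last exact: edot_linear.
by rewrite edotC edot_linear ![edot v _]edotC.
Qed.

Lemma edot_ge0 u : 0 <= edot u u.
Proof. by apply: sumr_ge0 => i _; rewrite -expr2 sqr_ge0. Qed.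

Lemma edot_eq0 u : edot u u = 0 -> u = 0.
Proof.
move=> /eqP; rewrite psumr_eq0 => [|i _]; last by rewrite -expr2 sqr_ge0.
move=> /allP u0; apply/rowP => i; rewrite mxE.
by have := u0 i; rewrite mem_index_enum => /(_ isT); rewrite mulf_eq0 orbb => /eqP.
Qed.

HB.instance Definition _ := bilinear_isBilinear.Build R E E R
  *%R (@idfun R \; *%R) edot edot_bilinear.
HB.instance Definition _ := isHermitianSesquilinear.Build R E false idfun edot
  (fun u v => etrans (edotC u v) (esym (mul1r (edot v u)))).

Lemma edot_gt0 u : u != 0 -> 0 < edot u u.
Proof.
move=> u0; rewrite lt_def edot_ge0 andbT.
by apply: contraNN u0 => /eqP/edot_eq0->.
Qed.

HB.instance Definition _ := isDotProduct.Build R E edot edot_gt0.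

Definition enorm u : R := Num.sqrt (edot u u).

Lemma sqr_enorm u : enorm u ^+ 2 = edot u u.
Proof. by rewrite sqr_sqrtr ?edot_ge0. Qed.

Lemma enormZ a u : enorm (a *: u) = `|a| * enorm u.
Proof.
rewrite /enorm linearZl_LR/= edotC linearZl_LR/= mulrA -expr2.
by rewrite sqrtrM ?sqr_ge0// sqrtr_sqr.
Qed.

Lemma enorm_eq0 u : enorm u = 0 -> u = 0.
Proof. by move=> u0; apply: edot_eq0; rewrite -sqr_enorm u0 expr0n. Qed.

Lemma edot_le_enorm u v : edot u v <= enorm u * enorm v.
Proof.
set a := enorm u; set b := enorm v.
have a0 : 0 <= a by exact: sqrtr_ge0.
have b0 : 0 <= b by exact: sqrtr_ge0.
have [/eqP|ab0] := boolP (a * b == 0).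
  move=> /[dup] ab0 /eqP; rewrite mulf_eq0 ab0 => /orP[]/eqP/enorm_eq0->.
    by rewrite linear0l.
  by rewrite edotC linear0l.
(* With a = |u| and b = |v| this square expands to 2ab (ab - <u, v>). *)
have := edot_ge0 (b *: u - a *: v).
rewrite linearBl linearZl_LR/= linearZl_LR/= ![edot _ (_ - _)]edotC.
rewrite !linearBl/= !linearZl_LR/= -!sqr_enorm -/a -/b (edotC v u) => h.
have {}ab0 : 0 < a * b by rewrite lt_def ab0 mulr_ge0.
rewrite -(ler_pM2l ab0); lra.
Qed.

Lemma enorm_triangle u v : enorm (u + v) <= enorm u + enorm v.
Proof.
rewrite -(@ler_pXn2r _ 2) ?nnegrE ?addr_ge0 ?sqrtr_ge0//.
rewrite sqrrD !sqr_enorm linearDl/= ![edot _ (u + v)]edotC !linearDl/=.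
have := edot_le_enorm u v; rewrite (edotC v u); lra.
Qed.

HB.instance Definition _ := Lmodule_isNormed.Build R E
  enorm_triangle enormZ enorm_eq0.

Lemma sqr_normE u : `|u| ^+ 2 = edot u u.
Proof. exact: sqr_enorm. Qed.

Lemma coor_le_norm u i : `|coor u i| <= `|u|.
Proof.
rewrite -(@ler_pXn2r _ 2) ?nnegrE// sqr_normE /edot (bigD1 i)//=.
rewrite real_normK ?num_real// expr2 lerDl.
by apply: sumr_ge0 => j _; rewrite -expr2 sqr_ge0.
Qed.

Lemma norm_le_coor u : `|u| <= \sum_i `|coor u i|.
Proof.
rewrite -(@ler_pXn2r _ 2) ?nnegrE ?sumr_ge0// sqr_normE /edot.
rewrite expr2 mulr_suml; apply: ler_sum => i _.
rewrite (le_trans (ler_norm _))// normrM ler_wpM2l//.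
by rewrite (bigD1 i)//= lerDl sumr_ge0.
Qed.

Lemma euclidP u v : (forall i, coor u i = coor v i) -> u = v.
Proof. by move=> uv; apply/rowP => i; exact: uv. Qed.

Lemma coor0 i : coor (0 : E) i = 0.
Proof. by rewrite /coor mxE. Qed.

Lemma coor_sum (I : Type) (r : seq I) (P : pred I) (F : I -> E) i :
  coor (\sum_(j <- r | P j) F j) i = \sum_(j <- r | P j) coor (F j) i.
Proof. exact: summxE. Qed.

Lemma normr_edot u v : `|edot u v| <= `|u| * `|v|.
Proof.
rewrite ler_norml edot_le_enorm andbT lerNl -(normrN u) -linearNl/=.
exact: edot_le_enorm.
Qed.

Lemma euclid_complete (F : set_system E) :
  ProperFilter F -> cauchy F -> cvg F.
Proof.
move=> FF /cauchyP Fc.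
have /choice[l cvl] i : exists l : R, ((fun u => coor u i) @ F --> l)%classic.
  apply/cvg_ex; apply: R_complete; apply: cauchy_exP => e /Fc[u Fu].
  exists (coor u i); apply: (@filterS _ F _ _ _ _ Fu) => v.
  rewrite -!ball_normE/= -coorB; exact: le_lt_trans (coor_le_norm _ _).
apply/cvg_ex; exists (\row_i l i : 'rV[R]_n).
apply/fcvgrPdist_lt => e e0.
(* Dividing by [n.+1] is safe for [n = 0], and the [n] coordinate errors then add up to strictly
   less than [e]. *)
have d0 : 0 < e / n.+1%:R by rewrite divr_gt0.
near=> u; rewrite (le_lt_trans (norm_le_coor _))//.
apply: (@le_lt_trans _ _ (\sum_(i < n) e / n.+1%:R)); last first.
  rewrite sumr_const card_ord -[ltLHS]mulr_natr -mulrA gtr_pMr// mulrC ltr_pdivrMr//.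
  by rewrite mul1r ltr_nat.
apply: ler_sum => i _; rewrite coorB /coor mxE.
move: i; near: u; apply: filter_forall => i.
move/cvgrPdist_lt : (cvl i) => /(_ _ d0) /= h.
by apply: filterS h => u /ltW.
Unshelve. all: by end_near. Qed.

HB.instance Definition _ := Uniform_isComplete.Build E euclid_complete.

Lemma euclid_hilbert : hilbert_dot (edot : {dot E for @idfun R}).
Proof. by move=> u; rewrite sqr_normE. Qed.

End Euclid.

(** * Chain sums as matrix powers *)

Definition fcons (n m : nat) (a : 'I_n) (f : {ffun 'I_m -> 'I_n}) :
    {ffun 'I_m.+1 -> 'I_n} :=
  [ffun r => if unlift ord0 r is Some s then f s else a].

Definition fbehead (n m : nat) (f : {ffun 'I_m.+1 -> 'I_n}) :
    {ffun 'I_m -> 'I_n} :=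
  [ffun r => f (lift ord0 r)].

Lemma fcons0 n m (a : 'I_n) (f : {ffun 'I_m -> 'I_n}) : fcons a f ord0 = a.
Proof. by rewrite ffunE unlift_none. Qed.

Lemma fconsS n m (a : 'I_n) (f : {ffun 'I_m -> 'I_n}) r :
  fcons a f (lift ord0 r) = f r.
Proof. by rewrite ffunE liftK. Qed.

Lemma fbeheadK n m (f : {ffun 'I_m.+1 -> 'I_n}) :
  fcons (f ord0) (fbehead f) = f.
Proof.
by apply/ffunP => r; case: (unliftP ord0 r) => [s|] ->;
  rewrite (fcons0, fconsS) // ffunE.
Qed.

Lemma fconsK n m (a : 'I_n) (f : {ffun 'I_m -> 'I_n}) : fbehead (fcons a f) = f.
Proof. by apply/ffunP => r; rewrite ffunE fconsS. Qed.

Lemma chainP (n m j : nat) (I J : {ffun 'I_m -> 'I_n}) :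
  reflect [/\ forall r : 'I_m, r = 0 :> nat -> (J r).+1 = j,
              forall r, (J r <= I r)%N
            & forall r s : 'I_m, r.+1 = s -> (I r < J s)%N]
          (chain j I J).
Proof.
apply: (iffP and3P) => -[h1 h2 h3]; split.
- by move=> r /eqP r0; move/forallP/(_ r)/implyP/(_ r0)/eqP: h1.
- exact/forallP.
- by move=> r s /eqP rs; move/forallP/(_ r)/forallP/(_ s)/implyP/(_ rs): h3.
- by apply/forallP => r; apply/implyP => /eqP/h1 ->.
- exact/forallP.
- by apply/forallP => r; apply/forallP => s; apply/implyP => /eqP/h3.
Qed.

Lemma chain_cons1 (n j : nat) (i0 j0 : 'I_n) (I J : {ffun 'I_0 -> 'I_n}) :
  chain j.+1 (fcons i0 I) (fcons j0 J) = (j0 == j :> nat) && (j0 <= i0)%N.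
Proof.
apply/chainP/andP => [[h1 h2 _]|[/eqP h1 h2]].
  by have := h1 ord0 erefl; have := h2 ord0; rewrite !fcons0 => ? [<-]; split.
split=> [r _|r|r s]; rewrite ?[r]ord1 ?[s]ord1 ?fcons0 ?h1 // -h1//.
Qed.

Lemma chain_cons (n m j : nat) (i0 j0 : 'I_n) (I J : {ffun 'I_m.+1 -> 'I_n}) :
  chain j.+1 (fcons i0 I) (fcons j0 J) =
  [&& j0 == j :> nat, (j0 <= i0)%N, (i0 < J ord0)%N & chain (J ord0).+1 I J].
Proof.
apply/chainP/and4P => [[h1 h2 h3]|[/eqP h1 h2 h3 /chainP[_ h5 h6]]]; split.
- by have := h1 ord0 erefl; rewrite fcons0 => -[->].
- by have := h2 ord0; rewrite !fcons0.
- by have := h3 ord0 (lift ord0 ord0) erefl; rewrite fcons0 fconsS.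
- apply/chainP; split=> [r r0|r|r s rs].
  + by congr (val (J _)).+1; apply/val_inj.
  + by have := h2 (lift ord0 r); rewrite !fconsS.
  + have := h3 (lift ord0 r) (lift ord0 s); rewrite !fconsS; apply.
    by rewrite /= /bump/= !add1n rs.
- by move=> r r0; have -> : r = ord0 by [apply/val_inj]; rewrite fcons0 h1.
- by move=> r; case: (unliftP ord0 r) => [s|] ->; rewrite !(fcons0, fconsS).
- move=> r s; case: (unliftP ord0 s) => [s'|] -> //.
  case: (unliftP ord0 r) => [r'|] ->; rewrite !(fcons0, fconsS)/= /bump/= !add1n.
    by move=> [/h6].
  by move=> [s0]; have <- : ord0 = s' by [apply/val_inj].
Qed.

Section QRecursion.
Variables (R : realType) (n : nat) (H : 'M[R]_n).

Lemma Q_cons m j : Q H m.+1 j.+1 =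
  \sum_i0 \sum_j0 \sum_(IJ : {ffun 'I_m -> 'I_n} * {ffun 'I_m -> 'I_n}
      | chain j.+1 (fcons i0 IJ.1) (fcons j0 IJ.2))
    H i0 j0 * \prod_(r < m) H (IJ.1 r) (IJ.2 r).
Proof.
pose h (x : ('I_n * 'I_n) * ({ffun 'I_m -> 'I_n} * {ffun 'I_m -> 'I_n})) :=
  (fcons x.1.1 x.2.1, fcons x.1.2 x.2.2).
rewrite /Q (reindex h)/=; last first.
  exists (fun y : {ffun 'I_m.+1 -> 'I_n} * {ffun 'I_m.+1 -> 'I_n} =>
    ((y.1 ord0, y.2 ord0), (fbehead y.1, fbehead y.2))).
    by move=> [[a b] [f g]] _; rewrite /h/= !fcons0 !fconsK.
  by move=> [f g] _; rewrite /h/= !fbeheadK.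
rewrite pair_bigA pair_big_dep/=; apply: eq_bigr => -[[a b] [f g]] _ /=.
by rewrite big_ord_recl !fcons0; congr (_ * _); apply: eq_bigr => r _; rewrite !fconsS.
Qed.

Lemma Q1 (j : 'I_n) : Q H 1 j.+1 = \sum_(i < n | (j <= i)%N) H i j.
Proof.
rewrite Q_cons [RHS]big_mkcond/=; apply: eq_bigr => i _.
rewrite (bigD1 j)//= [X in _ + X]big1 ?addr0; last first.
  move=> k kj; rewrite big_pred0// => IJ; rewrite chain_cons1.
  by rewrite (inj_eq val_inj) (negPf kj).
under eq_bigl do rewrite chain_cons1 eqxx/=.
case: ifP => ji; last by rewrite big_pred0.
have e (f g : {ffun 'I_0 -> 'I_n}) : f = g by apply/ffunP => -[].
pose f0 : {ffun 'I_0 -> 'I_n} := [ffun=> j].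
rewrite (bigD1 (f0, f0))//= big_ord0 mulr1 big_pred0 ?addr0// => -[f g] /=.
by rewrite (e f f0) (e g f0) eqxx.
Qed.

(** Removing the first pair (i, j) of a chain leaves a chain whose start j' is constrained only by i
    < j'. *)
Lemma QS m (j : 'I_n) : Q H m.+2 j.+1 =
  \sum_(i < n | (j <= i)%N) H i j * \sum_(j' < n | (i < j')%N) Q H m.+1 j'.+1.
Proof.
rewrite Q_cons [RHS]big_mkcond/=; apply: eq_bigr => i _.
rewrite (bigD1 j)//= [X in _ + X]big1 ?addr0; last first.
  move=> k kj; rewrite big_pred0// => IJ; rewrite chain_cons.
  by rewrite (inj_eq val_inj) (negPf kj).
under eq_bigl do rewrite chain_cons eqxx/=.
case: ifP => ji; last by rewrite big_pred0.
rewrite -mulr_sumr; congr (_ * _).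
pose P (IJ : {ffun 'I_m.+1 -> 'I_n} * {ffun 'I_m.+1 -> 'I_n}) :=
  (i < IJ.2 ord0)%N && chain (IJ.2 ord0).+1 IJ.1 IJ.2.
rewrite /Q (exchange_big_dep P)/=; last first.
  move=> j' [f g]/= ij /chainP[h1 h2 h3]; have := h1 ord0 erefl => -[e].
  by rewrite /P/= e ij /=; apply/chainP; split.
apply: eq_bigr => -[f g]/= /andP[ig /[dup] fg /chainP[_ h2 h3]].
rewrite (big_pred1 (g ord0))// => k /=; apply/andP/eqP => [[ik /chainP[h1 _ _]]|->//].
by have := h1 ord0 erefl => -[/val_inj].
Qed.

End QRecursion.

Section StepMatrix.
Variable R : realType.

Definition cumul (n : nat) : 'M[R]_(n.+1, n) := \matrix_(k, i) (i < k)%:R.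

Definition embed (n : nat) : 'M[R]_(n, n.+1) :=
  \matrix_(j, k) (j == k :> nat)%:R.

(** The matrix C of the overview: [cumul] adds up the updates made before an iterate, and [embed]
    appends a zero column for the last residual, which no update uses. *)
Definition stepmx (n : nat) (H : 'M[R]_n) : 'M[R]_n.+1 :=
  cumul n *m H *m embed n.

Lemma mulmx_embed (n p : nat) (A : 'M[R]_(p, n)) i j :
  (A *m embed n) i (widen_ord (leqnSn n) j) = A i j.
Proof.
rewrite mxE (bigD1 j)//= mxE eqxx mulr1 big1 ?addr0// => k kj.
by rewrite mxE/= (inj_eq val_inj) (negPf kj) mulr0.
Qed.

Lemma mulmx_embed_max (n p : nat) (A : 'M[R]_(p, n)) i :
  (A *m embed n) i ord_max = 0.
Proof.
by rewrite mxE big1// => k _; rewrite mxE/= ltn_eqF// mulr0.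
Qed.

Lemma mulmx_cumul (n p : nat) (A : 'M[R]_(p, n.+1)) i j :
  (A *m cumul n) i j = \sum_(k < n.+1 | (j < k)%N) A i k.
Proof.
rewrite mxE [RHS]big_mkcond; apply: eq_bigr => k _.
by rewrite mxE; case: ifP; rewrite (mulr1, mulr0).
Qed.

Lemma cumul_mulmx (n p : nat) (A : 'M[R]_(n, p)) i j :
  (cumul n *m A) i j = \sum_(k < n | (k < i)%N) A k j.
Proof.
rewrite mxE [RHS]big_mkcond; apply: eq_bigr => k _.
by rewrite mxE; case: ifP; rewrite (mul1r, mul0r).
Qed.

Variables (n : nat) (H : 'M[R]_n).
Local Notation C := (stepmx H).

Lemma widen_or_max (k : 'I_n.+1) :
  k = ord_max \/ exists j : 'I_n, k = widen_ord (leqnSn n) j.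
Proof.
case: (ltnP k n) => [kn|nk]; [right|left].
  by exists (Ordinal kn); apply/val_inj.
by apply/val_inj/eqP; rewrite eqn_leq nk -ltnS ltn_ord.
Qed.

Lemma stepmxE k j :
  C k (widen_ord (leqnSn n) j) = \sum_(i < n | (i < k)%N) H i j.
Proof. by rewrite mulmx_embed cumul_mulmx. Qed.

Definition qrow (m : nat) : 'rV[R]_n.+1 := row ord_max (C ^+ m).

Lemma qrow0 : qrow 0 = delta_mx 0 ord_max.
Proof. by rewrite /qrow expr0 rowE mulmx1. Qed.

Lemma qrowS m : qrow m.+1 = qrow m *m C.
Proof. by rewrite /qrow exprSr -row_mul. Qed.

Hypothesis Htrig : is_trig_mx H.

Lemma stepmx_lower (k j : 'I_n.+1) : (k <= j)%N -> C k j = 0.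
Proof.
case: (widen_or_max j) => [->|[{}j -> /= kj]]; first by rewrite /stepmx mulmx_embed_max.
rewrite stepmxE big1// => i ik.
by move/is_trig_mxP: Htrig; apply; apply: leq_trans kj.
Qed.

Lemma stepmx_exp_lower m (k j : 'I_n.+1) : (k < j + m)%N -> (C ^+ m) k j = 0.
Proof.
elim: m k j => [|m IH] k j kj.
  rewrite expr0 mxE; case: eqP => // kE.
  by move: kj; rewrite kE addn0 ltnn.
rewrite exprSr mxE big1// => i _.
have [ij|ji] := leqP i j; first by rewrite stepmx_lower ?mulr0.
by rewrite IH ?mul0r//; lia.
Qed.

Lemma stepmx_nilp m : (n < m)%N -> C ^+ m = 0.
Proof.
move=> nm; apply/matrixP => k j; rewrite mxE stepmx_exp_lower//.
by have := ltn_ord k; lia.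
Qed.

Lemma qrow_nilp m : (n < m)%N -> qrow m = 0.
Proof. by move=> nm; apply/rowP => j; rewrite !mxE stepmx_nilp ?mxE. Qed.

Lemma sum_lower (i j : 'I_n) (f : 'I_n -> R) :
  \sum_(i < n | (j <= i)%N) H i j * f i = \sum_i H i j * f i.
Proof.
rewrite [LHS]big_mkcond; apply: eq_bigr => k _.
case: leqP => // kj; move/is_trig_mxP: Htrig => ->//; exact: esym (mul0r _).
Qed.

(** In a product of copies of C, the factor [cumul] enforces i(r) < j(r+1) and the triangularity of
    [H] enforces j(r) <= i(r), so the last row of C^m sums over chains. *)
Lemma Q_qrow m (j : 'I_n) :
  Q H m.+1 j.+1 = qrow m.+1 0 (widen_ord (leqnSn n) j).
Proof.
elim: m j => [|m IH] j.
  rewrite Q1 qrowS /stepmx !mulmxA mulmx_embed mxE.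
  rewrite -(eq_bigr _ (fun i _ => mulr1 (H i j))) sum_lower//.
  apply: eq_bigr => i _; rewrite mulr1 mulmx_cumul qrow0 (bigD1 ord_max)//=.
  rewrite big1 ?mxE ?eqxx ?addr0 ?mul1r// => k /andP[_ /negPf kn].
  by rewrite mxE kn.
rewrite QS qrowS /stepmx !mulmxA mulmx_embed mxE sum_lower//.
apply: eq_bigr => i _; rewrite mulrC; congr (_ * _); rewrite mulmx_cumul.
have q0 : qrow m.+1 0 ord_max = 0 by rewrite qrowS /stepmx !mulmxA mulmx_embed_max.
rewrite [RHS]big_mkcond big_ord_recr/= q0 if_same addr0.
by rewrite [LHS]big_mkcond; apply: eq_bigr => k _; rewrite IH.
Qed.

End StepMatrix.

(** * Gram matrices of polynomials in z - 1 *)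

Section PascalGram.
Variables (R : realType) (N : nat).
Implicit Types (u : nat -> 'rV[R]_N) (K : 'M[R]_N).

(** The coefficient inner product of (z - 1)^l and (z - 1)^m, by Vandermonde's identity. *)
Definition pascal (l m : nat) : R := (-1) ^+ (l + m) * 'C(l + m, m)%:R.

Lemma pascalC l m : pascal l m = pascal m l.
Proof.
rewrite /pascal [in RHS]addnC; congr (_ * _%:R).
by rewrite -(bin_sub (leq_addl l m)) addnK.
Qed.

(** With d = z - 1, the isometry <zf, zg> = <f, g> reads <df, dg> + <df, g> + <f, dg> = 0. *)
Lemma pascalSS l m :
  pascal l.+1 m.+1 + pascal l.+1 m + pascal l m.+1 = 0.
Proof.
rewrite /pascal !addSn !addnS binS natrD !exprS -[(l + m).+1]addSn.
ring.
Qed.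

Lemma pascal0 l : pascal l 0 = (-1) ^+ l.
Proof. by rewrite /pascal addn0 bin0 mulr1. Qed.

Definition pgram u : 'M[R]_N :=
  \sum_(l < N) \sum_(m < N) pascal l m *: ((u l)^T *m u m).

Lemma pgram_tr u : (pgram u)^T = pgram u.
Proof.
rewrite /pgram linear_sum/= [RHS]exchange_big; apply: eq_bigr => l _.
rewrite linear_sum/=; apply: eq_bigr => m _.
by rewrite linearZ/= trmx_mul trmxK pascalC.
Qed.

Lemma pgramE u a b :
  pgram u a b = \sum_(l < N) \sum_(m < N) pascal l m * (u l 0 a * u m 0 b).
Proof.
rewrite summxE; apply: eq_bigr => l _; rewrite summxE; apply: eq_bigr => m _.
by rewrite !mxE big_ord1 mxE.
Qed.

(* The Gram matrix of [\sum_l (z - 1)^l u l] for the coefficient inner product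
   on polynomials in [z]; multiplication by [z] is an isometry, which becomes
   Pascal's rule. *)
Lemma pgram_lyapunov u K :
    (forall m, u m.+1 = u m *m K) -> (forall m, (N <= m)%N -> u m = 0) ->
  pgram u + pgram u *m K + K^T *m pgram u = (u 0%N)^T *m u 0%N.
Proof.
move=> uS u0.
pose F l m := (u l)^T *m u m.
have F0l l m : (N <= l)%N -> F l m = 0 by move=> h; rewrite /F u0// trmx0 mul0mx.
have F0m l m : (N <= m)%N -> F l m = 0 by move=> h; rewrite /F [u m]u0// mulmx0.
(* All three sums are brought to the common range [N.+1] by [N.+1], where the added terms vanish;
   they then cancel index by index except at (0, 0). *)
have E (b : nat -> nat -> R) : \sum_(l < N) \sum_(m < N) b l m *: F l m =
    \sum_(l < N.+1) \sum_(m < N.+1) b l m *: F l m :> 'M[R]_N.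
  rewrite [RHS]big_ord_recr/= [X in _ + X]big1 ?addr0 => [|m _]; last by rewrite F0l ?scaler0.
  by apply: eq_bigr => l _; rewrite [RHS]big_ord_recr/= F0m// scaler0 addr0.
have -> : pgram u *m K =
    \sum_(l < N.+1) \sum_(m < N.+1) (if (m : nat) is m'.+1 then pascal l m' else 0) *: F l m.
  rewrite [RHS]big_ord_recr/= [X in _ + X]big1 ?addr0 => [|m _]; last by rewrite F0l ?scaler0.
  rewrite mulmx_suml; apply: eq_bigr => l _.
  rewrite big_ord_recl/= scale0r add0r mulmx_suml; apply: eq_bigr => m _.
  by rewrite -scalemxAl -mulmxA -uS.
have -> : K^T *m pgram u =
    \sum_(l < N.+1) \sum_(m < N.+1) (if (l : nat) is l'.+1 then pascal l' m else 0) *: F l m.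
  rewrite big_ord_recl/= [X in _ = X + _]big1 ?add0r => [|m _]; last by rewrite scale0r.
  rewrite mulmx_sumr; apply: eq_bigr => l _.
  rewrite [RHS]big_ord_recr/= F0m// scaler0 addr0 mulmx_sumr; apply: eq_bigr => m _.
  by rewrite -scalemxAr mulmxA -trmx_mul -uS.
rewrite /pgram E -!big_split/= big_ord_recl/= -!big_split/= big_ord_recl/=.
rewrite pascal0 expr0 scale1r !scale0r !addr0 big1 ?addr0 => [|m _]; last first.
  rewrite scale0r addr0 -scalerDl /= /bump/= add1n.
  have := pascalC 0 m.+1; rewrite pascal0 => ->.
  by have := pascalC 0 m; rewrite pascal0 => ->; rewrite exprS mulN1r addNr scale0r.
rewrite big1 ?addr0// => l _; rewrite -!big_split/= big1// => m _.
rewrite -!scalerDl/= /bump/= add1n; case: (m : nat) => [|m'].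
  by rewrite !pascal0 exprS mulN1r addr0 addNr scale0r.
by rewrite pascalSS scale0r.
Qed.

End PascalGram.

(** * Certificates as Gram entries, and their behaviour under the H-dual *)

Section Certificates.
Variables (R : realType) (n : nat).
Implicit Types H : 'M[R]_n.

(** The column C^m 1, transposed so that [pgram] applies; the resulting Gram matrix is the P of the
    overview. *)
Definition prow H (m : nat) : 'rV[R]_n.+1 := (stepmx H ^+ m *m const_mx 1)^T.

Definition invariant H (m : nat) : R := prow H m 0 ord_max.

(* The H-invariance conditions [Q(k,1) + ... + Q(k,N-1) = 'C(N, k+1) / N] in
   the inverted form in which they are used. *)
Definition balanced H : Prop :=
  forall l : nat, (l <= n)%N ->
    \sum_(m < n.+1) pascal R l m * invariant H m = (l == 0%N)%:R / n.+1%:R.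

Definition gram H : 'M[R]_n.+1 := pgram (qrow H).

Lemma prow0 H : prow H 0 = const_mx 1.
Proof. by rewrite /prow expr0 mul1mx trmx_const. Qed.

Lemma prowS H m : prow H m.+1 = prow H m *m (stepmx H)^T.
Proof. by rewrite /prow exprS -mulmxA trmx_mul. Qed.

Lemma stepmx_max H k : stepmx H k ord_max = 0.
Proof. exact: mulmx_embed_max. Qed.

Lemma prowSE H m k :
  prow H m.+1 0 k = \sum_j prow H m 0 j * stepmx H k j.
Proof. by rewrite prowS mxE; apply: eq_bigr => j _; rewrite [(stepmx H)^T _ _]mxE. Qed.

Lemma prow_nilp H m : is_trig_mx H -> (n < m)%N -> prow H m = 0.
Proof. by move=> Ht nm; rewrite /prow stepmx_nilp// mul0mx trmx0. Qed.

Lemma invariantE H m : invariant H m = \sum_j qrow H m 0 j.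
Proof. by rewrite /invariant !mxE; apply: eq_bigr => j _; rewrite !mxE mulr1. Qed.

Lemma gram_sym H a b : gram H a b = gram H b a.
Proof. by rewrite /gram -[in LHS]pgram_tr mxE. Qed.

(** Summing over b turns [qrow H m] into [invariant H m]; [balanced] then keeps only l = 0, whose
    row is the last unit vector. *)
Lemma gram_rowsum H a : balanced H ->
  \sum_b gram H a b = (a == ord_max)%:R / n.+1%:R.
Proof.
move=> Hb; under eq_bigr do rewrite pgramE.
rewrite exchange_big/=.
under eq_bigr => l _ do rewrite exchange_big/=.
transitivity (\sum_(l < n.+1) qrow H l 0 a * ((l == 0%N :> nat)%:R / n.+1%:R)).
  apply: eq_bigr => l _; rewrite -Hb -1?ltnS ?ltn_ord// mulr_sumr.
  apply: eq_bigr => m _; rewrite invariantE mulrCA !mulr_sumr.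
  by apply: eq_bigr => b _; rewrite mulrCA.
rewrite big_ord_recl big1 ?addr0 => [|l _]; last by rewrite mul0r mulr0.
by rewrite qrow0 mxE eqxx/= mul1r.
Qed.

Lemma gram_lyapunov H : is_trig_mx H ->
  gram H + gram H *m stepmx H + (stepmx H)^T *m gram H = delta_mx ord_max ord_max.
Proof.
move=> Ht; rewrite (pgram_lyapunov (qrowS H)); last by move=> m; exact: qrow_nilp.
by rewrite qrow0 trmx_delta mul_delta_mx.
Qed.

Lemma pgram_prow_lyapunov H (P := pgram (prow H)) : is_trig_mx H ->
  P + P *m (stepmx H)^T + stepmx H *m P = const_mx 1.
Proof.
move=> Ht; rewrite -[X in _ + X *m P]trmxK.
rewrite (pgram_lyapunov (prowS H)); last by move=> m; exact: prow_nilp.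
by apply/matrixP => i j; rewrite prow0 mxE big_ord1 !mxE mulr1.
Qed.

Lemma qrow0_widen H (j : 'I_n) : qrow H 0 0 (widen_ord (leqnSn n) j) = 0.
Proof. by rewrite qrow0 mxE /= -val_eqE/= ltn_eqF. Qed.

Lemma signr_pred (l : nat) : (0 < l)%N -> (-1) ^+ l.-1 = - (-1) ^+ l :> R.
Proof. by case: l => // l _; rewrite exprS mulN1r opprK. Qed.

Lemma Hcert_gram H (a b : 'I_n.+1) : is_trig_mx H -> (b < a)%N ->
  @Hcert R n.+1 H a.+1 b.+1 = - (n.+1%:R * gram H a b).
Proof.
move=> Ht ba; rewrite /Hcert gram_sym -mulrN; case: (widen_or_max b) => [be|[b' be]].
  by move: ba; rewrite be ltnNge -ltnS ltn_ord.
have sumQ (F : nat -> R) c : \sum_(1 <= m < n.+1) F m * Q H m (c : 'I_n).+1 =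
    \sum_(m < n.+1) F m * qrow H m 0 (widen_ord (leqnSn n) c).
  rewrite big_ord_recl/= qrow0_widen mulr0 add0r big_add1/= big_mkord.
  by apply: eq_bigr => m _; rewrite Q_qrow.
(* Passing from exponent [l.-1] to [l] costs a sign; at [l = 0], where it would not, the row
   vanishes at [b]. *)
have neg (l : nat) : qrow H l 0 b * (-1) ^+ l.-1 = - (qrow H l 0 b * (-1) ^+ l).
  by case: l => [|l]; rewrite ?be ?qrow0_widen ?mul0r ?oppr0// signr_pred// mulrN.
rewrite eqSS; case: (widen_or_max a) => [->|[{ba}a ->]]/=.
  rewrite eqxx [in LHS]be (sumQ (fun m => (-1) ^+ m.-1)) -be; congr (_ * _).
  rewrite pgramE -sumrN; apply: eq_bigr => l _.
  rewrite big_ord_recl/= big1 => [|m _]; last first.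
    by rewrite qrowS /stepmx mulmxA mulmx_embed_max !mulr0.
  have -> : qrow H 0 0 ord_max = 1 by rewrite qrow0 mxE !eqxx.
  by rewrite pascal0 mulr1 addr0 mulrC neg mulrC.
rewrite ltn_eqF//; congr (_ * _); rewrite pgramE -sumrN [in LHS]be.
pose F (l : nat) : R := \sum_(m < n.+1) (-1) ^+ (l + m).-1 *
  'C(l + m, m)%:R * qrow H m 0 (widen_ord (leqnSn n) a).
transitivity (\sum_(1 <= l < n.+1) F l * Q H l b'.+1).
  apply: eq_bigr => l _.
  rewrite (sumQ (fun m => (-1) ^+ (l + m).-1 * 'C(l + m, m)%:R * Q H l b'.+1)).
  by rewrite mulr_suml; apply: eq_bigr => m _; rewrite mulrAC.
rewrite sumQ; apply: eq_bigr => l _; rewrite -be mulr_suml -sumrN.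
apply: eq_bigr => m _; case: (posnP l) => [->|l0].
  by rewrite be qrow0_widen mul0r !mulr0 oppr0.
rewrite signr_pred ?addn_gt0 ?l0// /pascal; ring.
Qed.

Lemma Hdual_trig H : is_trig_mx H -> is_trig_mx (@Hdual R n.+1 H).
Proof.
move=> /is_trig_mxP Ht; apply/is_trig_mxP => i j ij; rewrite mxE Ht//=.
by apply: ltn_sub2l => //; exact: leq_ltn_trans ij (ltn_ord j).
Qed.

Definition backdiff (f : 'I_n.+1 -> R) (k : 'I_n.+1) : R :=
  f k - (if unlift ord0 k is Some i then f (widen_ord (leqnSn n) i) else 0).

Lemma backdiff0 f : backdiff f ord0 = f ord0.
Proof. by rewrite /backdiff unlift_none subr0. Qed.

Lemma backdiffS f i :
  backdiff f (lift ord0 i) = f (lift ord0 i) - f (widen_ord (leqnSn n) i).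
Proof. by rewrite /backdiff liftK. Qed.

Lemma sum_backdiff f (j : 'I_n.+1) :
  \sum_(k < n.+1 | (k <= j)%N) backdiff f k = f j.
Proof.
pose g (k : nat) : R := if k is k'.+1 then f (inord k') else 0.
rewrite (eq_bigr (fun k : 'I_n.+1 => g k.+1 - g k)); last first.
  move=> k _; rewrite /g inord_val; case: (unliftP ord0 k) => [i|] -> /=.
    rewrite backdiffS; congr (_ - f _); apply/val_inj.
    by rewrite /= inordK// (leq_trans (ltn_ord i)).
  by rewrite backdiff0 subr0.
rewrite -(@big_ord_widen _ _ _ j.+1 n.+1 (fun k => g k.+1 - g k))//.
by rewrite -(big_mkord xpredT (fun k => g k.+1 - g k)) telescope_sumr//= subr0 inord_val.
Qed.

Lemma prow_step H m (i : 'I_n) :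
  backdiff (prow H m.+1 0) (lift ord0 i) =
  \sum_j H i j * prow H m 0 (widen_ord (leqnSn n) j).
Proof.
rewrite backdiffS !prowSE -sumrB big_ord_recr/= !stepmx_max !mulr0 subrr addr0.
apply: eq_bigr => j _; rewrite -mulrBr mulrC; congr (_ * _).
rewrite !stepmxE (bigD1 i)/=; last by rewrite /bump/= add1n.
rewrite -addrA -[RHS]addr0; congr (_ + _); apply/eqP; rewrite subr_eq0; apply/eqP.
apply: eq_bigl => k; rewrite /bump/= add1n ltnS -val_eqE/=; lia.
Qed.

(** Differencing strips the factor [cumul] from C and leaves [H] applied to partial sums of the
    previous differences. After index reversal this is the recursion of [qrow] for the dual. *)
Lemma qrow_dual H m (k : 'I_n.+1) : is_trig_mx H ->
  qrow (@Hdual R n.+1 H) m 0 (rev_ord k) = backdiff (prow H m 0) k.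
Proof.
move=> Ht; elim: m k => [|m IH] k.
  rewrite qrow0 mxE eqxx/=; case: (unliftP ord0 k) => [i|] ->.
    rewrite backdiffS !prow0 !mxE subrr -val_eqE/= /bump/=.
    by have := ltn_ord i; case: eqP => //=; lia.
  rewrite backdiff0 prow0 mxE; case: eqP => // -[]; apply/val_inj => /=; lia.
case: (unliftP ord0 k) => [i|] ->; last first.
  have -> : rev_ord ord0 = ord_max :> 'I_n.+1 by apply/val_inj => /=; lia.
  rewrite qrowS mxE big1 => [|j _]; last by rewrite stepmx_max mulr0.
  rewrite backdiff0 prowSE big1// => j _.
  by rewrite stepmx_lower ?mulr0.
have -> : rev_ord (lift ord0 i) = widen_ord (leqnSn n) (rev_ord i).
  by apply/val_inj => /=; rewrite /bump/=; lia.
rewrite prow_step qrowS /stepmx !mulmxA mulmx_embed mxE.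
rewrite (reindex_inj rev_ord_inj)/=; apply: eq_bigr => j _.
have -> : @Hdual R n.+1 H (rev_ord j) (rev_ord i) = H i j by rewrite mxE !rev_ordK.
rewrite mulrC; congr (_ * _); rewrite mulmx_cumul.
rewrite -sum_backdiff (reindex_inj rev_ord_inj)/=.
apply: eq_big => [k'|k' _]; last exact: IH.
by have := ltn_ord j; have := ltn_ord k'; rewrite /=; lia.
Qed.

(** The row sum of the dual is a telescoping sum of differences. *)
Lemma invariant_dual H m : is_trig_mx H ->
  invariant (@Hdual R n.+1 H) m = invariant H m.
Proof.
move=> Ht; rewrite invariantE (reindex_inj rev_ord_inj)/=.
under eq_bigr do rewrite qrow_dual//.
rewrite -[RHS]sum_backdiff; apply: eq_bigl => k; exact/esym/leq_ord.
Qed.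

Lemma balanced_dual H : is_trig_mx H -> balanced H -> balanced (@Hdual R n.+1 H).
Proof.
move=> Ht Hb l ln; rewrite -Hb//; apply: eq_bigr => m _.
by rewrite invariant_dual.
Qed.

Lemma gram_dual H (P := pgram (prow H)) (i j : 'I_n.+1) : is_trig_mx H ->
  gram (@Hdual R n.+1 H) (rev_ord i) (rev_ord j) =
  backdiff (fun a => backdiff (P a) j) i.
Proof.
move=> Ht; rewrite pgramE.
under eq_bigr do under eq_bigr do rewrite !qrow_dual//.
rewrite /backdiff.
case: unlift => [i'|]; case: unlift => [j'|]; rewrite ?subr0 !pgramE -?sumrB -?sumrB -?sumrB;
  apply: eq_bigr => l _; rewrite -?sumrB -?sumrB -?sumrB; apply: eq_bigr => m _; ring.
Qed.

End Certificates.

(** * Sufficiency of the certificates *)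

Lemma sum_lt_sym (R : realType) (N : nat) (f : 'I_N -> 'I_N -> R) :
    (forall a b, f a b = f b a) -> (forall a, f a a = 0) ->
  2 * (\sum_(a < N) \sum_(b < N | (b < a)%N) f a b) = \sum_(a < N) \sum_(b < N) f a b.
Proof.
move=> fC f0; rewrite mulr_natl mulr2n.
rewrite [X in _ + X](exchange_big_dep xpredT)//= -big_split/=.
apply: eq_bigr => a _; rewrite [RHS](bigID (fun b : 'I_N => (b < a)%N))/=; congr (_ + _).
rewrite [RHS](bigID (pred1 a))/= [X in _ = X + _]big1 ?add0r => [|b /andP[_ /eqP->]//].
apply: eq_big => [b|b _]; last exact: fC.
by rewrite -leqNgt ltn_neqAle andbC eq_sym.
Qed.

Section DotTheory.
Variables (R : realType) (X : lmodType R) (dot : {dot X for @idfun R}).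
Implicit Types u v w : X.

Lemma dotC u v : dot u v = dot v u.
Proof. by rewrite hermitian_subproof expr0 mul1r. Qed.

Lemma dotDl u v w : dot (u + v) w = dot u w + dot v w.
Proof. exact: linearDl. Qed.

Lemma dotDr u v w : dot u (v + w) = dot u v + dot u w.
Proof. by rewrite ![dot u _]dotC dotDl. Qed.

Lemma dotNl u v : dot (- u) v = - dot u v.
Proof. exact: linearNl. Qed.

Lemma dotNr u v : dot u (- v) = - dot u v.
Proof. by rewrite ![dot u _]dotC dotNl. Qed.

Lemma dotZl a u v : dot (a *: u) v = a * dot u v.
Proof. exact: linearZl_LR. Qed.

Lemma dotZr a u v : dot u (a *: v) = a * dot u v.
Proof. by rewrite ![dot u _]dotC dotZl. Qed.

Lemma dot0l u : dot 0 u = 0. Proof. exact: linear0l. Qed.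

Lemma dot_suml (I : Type) (r : seq I) (P : pred I) (F : I -> X) v :
  dot (\sum_(i <- r | P i) F i) v = \sum_(i <- r | P i) dot (F i) v.
Proof. exact: linear_sumlz. Qed.

Lemma dot_sumr (I : Type) (r : seq I) (P : pred I) (F : I -> X) v :
  dot v (\sum_(i <- r | P i) F i) = \sum_(i <- r | P i) dot v (F i).
Proof. by rewrite dotC dot_suml; apply: eq_bigr => i _; rewrite dotC. Qed.

Lemma dot_ge0 u : 0 <= dot u u.
Proof.
by have [->|u0] := eqVneq u 0; [rewrite dot0l|exact/ltW/neq0_dnorm_gt0].
Qed.

Definition dotE := (dotDl, dotDr, dotNl, dotNr, dotZl, dotZr).

End DotTheory.

Section Certificate.
Variables (R : realType) (n : nat) (H : 'M[R]_n).
Hypotheses (Htrig : is_trig_mx H) (Hbal : balanced H).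
Local Notation C := (stepmx H).

(** The weights are the off-diagonal entries of -L, where L = N Gamma - e_N e_N^T is symmetric with
    zero row sums. The weighted sum therefore collapses to a trace against the Gram matrix of the
    residuals, which the equation for Gamma evaluates. *)
Lemma certificate_identity (X : lmodType R) (dot : {dot X for @idfun R})
    (x0 : X) (x g : 'I_n.+1 -> X) :
    (forall a, x a = x0 - \sum_b C a b *: g b) ->
  \sum_(a < n.+1) \sum_(b < n.+1 | (b < a)%N) - (n.+1%:R * gram H a b) *
    (2 * dot (x a - x b) (g a - g b) - dot (g a - g b) (g a - g b)) =
  - (n%:R * dot (g ord_max) (g ord_max)) - 2 * dot (x ord_max - x0) (g ord_max).
Proof.
move=> xE.
pose G : 'M[R]_n.+1 := \matrix_(a, b) dot (g a) (g b).
pose E : 'M[R]_n.+1 := delta_mx ord_max ord_max.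
pose L : 'M[R]_n.+1 := n.+1%:R *: gram H - E.
pose T a b := 2 * dot (x a) (g b) - dot (g a) (g b).
have Lsym a b : L a b = L b a.
  by rewrite !mxE gram_sym [in LHS]andbC.
have L1 a : \sum_b L a b = 0.
  under eq_bigr do rewrite !mxE.
  rewrite sumrB -mulr_sumr gram_rowsum// [X in _ - X](bigD1 ord_max)//=.
  rewrite big1 => [|b /negPf bm]; last by rewrite bm andbF.
  by rewrite eqxx andbT addr0 mulrC divfK ?subrr// pnatr_eq0.
have offdiag a b : a != b -> L a b = n.+1%:R * gram H a b.
  move=> ab; rewrite !mxE; case: eqP => [am|_]; last by rewrite subr0.
  by rewrite am eq_sym in ab *; rewrite (negPf ab) subr0.
have Edot a b : 2 * dot (x a - x b) (g a - g b) - dot (g a - g b) (g a - g b) =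
    T a a + T b b - T a b - T b a.
  rewrite /T !dotE (dotC dot (g b) (g a)); ring.
have swap F : \sum_a \sum_b L a b * F b a = \sum_a \sum_b L a b * F a b :> R.
  rewrite exchange_big/=; apply: eq_bigr => a _; apply: eq_bigr => b _.
  by rewrite Lsym.
have diag (t : 'I_n.+1 -> R) : \sum_a \sum_b L a b * t a = 0.
  by rewrite big1// => a _; rewrite -mulr_suml L1 mul0r.
have diagr (t : 'I_n.+1 -> R) : \sum_a \sum_b L a b * t b = 0.
  by rewrite (swap (fun a _ => t a)) diag.
(* Zero row and column sums remove the terms [T a a] and [T b b], and symmetry identifies the two
   mixed ones. *)
transitivity (\sum_a \sum_b L a b * T a b).
  pose f a b := - L a b * (T a a + T b b - T a b - T b a).
  rewrite (eq_bigr (fun a : 'I_n.+1 => \sum_(b < n.+1 | (b < a)%N) f a b)); last first.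
    move=> a _; apply: eq_bigr => b ba; rewrite Edot /f offdiag//.
    by rewrite -val_eqE/= gtn_eqF.
  have two0 : (2 : R) != 0 by rewrite pnatr_eq0.
  apply: (mulfI two0); rewrite sum_lt_sym; last 2 first.
  - by move=> a b; rewrite /f Lsym; congr (_ * _); ring.
  - by move=> a; rewrite /f; ring.
  have -> : \sum_a \sum_b f a b = \sum_a \sum_b L a b * T a b +
      \sum_a \sum_b L a b * T b a - (\sum_a \sum_b L a b * T a a +
      \sum_a \sum_b L a b * T b b).
    rewrite -!big_split/= -sumrB; apply: eq_bigr => a _.
    rewrite -!big_split/= -sumrB; apply: eq_bigr => b _; rewrite /f; ring.
  rewrite (swap T) diag diagr; ring.
have trL (B : 'M[R]_n.+1) : \sum_a \sum_b L a b * B a b = \tr (L *m B).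
  by rewrite -swap; apply: eq_bigr => a _; rewrite mxE.
have Gtr : G^T = G by apply/matrixP => a b; rewrite !mxE dotC.
have GE a b : G a b = dot (g a) (g b) by rewrite mxE.
have CGE a b : (C *m G) a b = \sum_c C a c * dot (g c) (g b).
  by rewrite [LHS]mxE; apply: eq_bigr => c _; rewrite GE.
have LT : L^T = L by apply/matrixP => a b; rewrite mxE Lsym.
(* Substituting the iterates, [x0] drops out because the columns of [L] sum to zero, and the
   remaining part contributes [C *m G]. *)
transitivity (- \tr ((L + L *m C + C^T *m L) *m G)).
  have -> : \tr ((L + L *m C + C^T *m L) *m G) = \tr (L *m G) + 2 * \tr (L *m (C *m G)).
    rewrite 2!mulmxDl 2!mxtraceD -addrA mulmxA mulr_natl mulr2n; congr (_ + (_ + _)).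
    rewrite -[LHS]mxtrace_tr 2!trmx_mul trmxK Gtr LT mxtrace_mulC.
    by [].

  rewrite -!trL mulr_sumr -[RHS]subr0 -[X in _ - X](diagr (fun b => - 2 * dot x0 (g b))).
  rewrite -big_split/= -sumrN -sumrB.
  apply: eq_bigr => a _; rewrite mulr_sumr -big_split/= -sumrN -sumrB.
  apply: eq_bigr => b _; rewrite /T xE dotDl dotNl dot_suml CGE GE.
  under eq_bigr do rewrite dotZl.
  ring.
have trE (B : 'M[R]_n.+1) : \tr (E *m B) = B ord_max ord_max.
  rewrite /mxtrace (bigD1 ord_max)//= !mxE (bigD1 ord_max)//= mxE !eqxx mul1r.
  rewrite !big1 ?addr0// => [a /negPf am|b /negPf bm]; last by rewrite mxE bm andbF mul0r.
  by rewrite mxE big1// => b _; rewrite mxE am mul0r.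
(* The Lyapunov equation leaves only terms supported at the last node, so the trace sees only the
   last residual. *)
have -> : L + L *m C + C^T *m L = n.+1%:R *: E - (E + E *m C + C^T *m E).
  rewrite /E -[X in _ *: X](gram_lyapunov Htrig) -/E /L.
  rewrite mulmxBl mulmxBr -scalemxAl -scalemxAr !scalerDr.
  move: (gram H *m C) (E *m C) (C^T *m _) (C^T *m _) => A1 A2 A3 A4.
  by apply/matrixP => i j; rewrite !mxE; ring.
have trCE : \tr (C^T *m E *m G) = (C *m G) ord_max ord_max.
  rewrite -mxtrace_tr 2!trmx_mul trmxK Gtr (_ : E^T = E) ?trmx_delta//.
  by rewrite mxtrace_mulC -mulmxA trE.
rewrite mulmxBl -scalemxAl 2!mulmxDl linearB/= mxtraceZ 2!mxtraceD trCE -(mulmxA E).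
rewrite !trE.
have CG : (C *m G) ord_max ord_max = - dot (x ord_max - x0) (g ord_max).
  rewrite xE addrAC subrr add0r dotNl opprK dot_suml CGE.
  by apply: eq_bigr => b _; rewrite dotZl.
rewrite CG GE -natr1; ring.
Qed.

End Certificate.

Lemma generates_stepmx (R : realType) (n : nat) (H : 'M[R]_n) (X : normedModType R)
    (T : X -> X) (y : nat -> X) (Htrig : is_trig_mx H) :
  @generates R n.+1 H X T y <->
  forall k : 'I_n.+1, y k = y 0%N -
    \sum_(j < n.+1) stepmx H k j *: (y j - T (y j)).
Proof.
have step (k : 'I_n.+1) : \sum_(j < n.+1) stepmx H k j *: (y j - T (y j)) =
    \sum_(i < n | (i < k)%N) \sum_(j < n) H i j *: (y j - T (y j)).
  rewrite big_ord_recr/= stepmx_max scale0r addr0 exchange_big/=.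
  by apply: eq_bigr => j _; rewrite stepmxE scaler_suml.
have trig (k : 'I_n) : \sum_(j < n | (j <= k)%N) H k j *: (y j - T (y j)) =
    \sum_(j < n) H k j *: (y j - T (y j)).
  rewrite big_mkcond/=; apply: eq_bigr => j _; case: leqP => // kj.
  by move/is_trig_mxP: Htrig => ->//; rewrite scale0r.
have split (k : 'I_n) : \sum_(i < n | (i < k.+1)%N) \sum_(j < n) H i j *: (y j - T (y j)) =
    \sum_(i < n | (i < k)%N) \sum_(j < n) H i j *: (y j - T (y j)) +
    \sum_(j < n) H k j *: (y j - T (y j)).
  rewrite (bigD1 k)//= addrC; congr (_ + _); apply: eq_bigl => i.
  by rewrite -val_eqE/= ltnS ltn_neqAle andbC.
split=> [yg|yE k].
  case=> k kn; elim: k kn => [|k IH] kn.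
    by rewrite step big_pred0 ?subr0.
  pose ko : 'I_n := Ordinal (kn : k < n)%N.
  have -> : y k.+1 = y k - \sum_(j < n) H ko j *: (y j - T (y j)).
    by rewrite -trig; exact: (yg ko).
  by rewrite (IH (ltnW kn)) !step (split ko) opprD addrA.
pose ko : 'I_n := k.
suff : y ko.+1 = y ko - \sum_(j < n) H ko j *: (y j - T (y j)) by rewrite -trig.
have := yE (lift ord0 ko); rewrite step /= /bump/= add1n (split ko) => ->.
have /= -> := yE (widen_ord (leqnSn n) ko); rewrite step /=.
by rewrite opprD addrA.
Qed.

Section Sufficiency.
Variables (R : realType) (n : nat) (H : 'M[R]_n).
Hypotheses (Htrig : is_trig_mx H) (Hbal : balanced H).
Hypothesis Hneg : forall a b : 'I_n.+1, (b < a)%N -> gram H a b <= 0.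

Lemma Hstar_of_gram : @Hstar R n.+1 H.
Proof.
split=> // X dot hdot T xs y Tne Txs /(generates_stepmx _ _ Htrig) yE.
have norm2 (u : X) : `|u| ^+ 2 = dot u u by rewrite hdot.
(* Nonexpansiveness in terms of residuals: this quantity equals |u - v|^2 - |Tu - Tv|^2. *)
have nexp (u v : X) :
    0 <= 2 * dot (u - v) ((u - T u) - (v - T v)) -
         dot ((u - T u) - (v - T v)) ((u - T u) - (v - T v)).
  have : `|T u - T v| ^+ 2 <= `|u - v| ^+ 2 by rewrite ler_pXn2r ?nnegrE.
  rewrite !norm2 => h.
  rewrite -subr_ge0 in h; apply: le_trans h _; rewrite le_eqVlt; apply/orP; left.
  apply/eqP; rewrite !dotE !(dotC dot (T _) u) !(dotC dot (T _) v) (dotC dot v u).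
  rewrite (dotC dot (T v) (T u)); ring.
pose g (a : 'I_n.+1) := y a - T (y a).
have := certificate_identity Htrig Hbal dot (g := g) yE.
set S := (X in X = _) => SE.
have S0 : 0 <= S.
  apply: sumr_ge0 => a _; apply: sumr_ge0 => b ba.
  by rewrite mulr_ge0 ?nexp// oppr_ge0 mulr_ge0_le0// Hneg.
have := nexp (y n) xs; rewrite Txs subrr subr0 -/(g ord_max) => Sn.
(* With d = y_0 - y_*, adding [S0] and [Sn] gives N |g_N|^2 <= 2 <d, g_N>; this square converts it
   into N^2 |g_N|^2 <= 4 |d|^2. *)
have sq : 0 <= dot (2 *: (y 0%N - xs) - n.+1%:R *: g ord_max)
                   (2 *: (y 0%N - xs) - n.+1%:R *: g ord_max) by exact: dot_ge0.
move: SE S0 Sn sq; rewrite !norm2 -/(g ord_max) /= => ->.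
have N0 : 0 < n.+1%:R :> R by rewrite ltr0n.
rewrite ler_pdivlMr ?exprn_gt0//.
have -> : y n - xs = (y n - y 0%N) + (y 0%N - xs) by rewrite addrA subrK.
move: (y 0%N - xs) => d; move: (g ord_max) (y n) (y 0%N) => gN yn y0.
rewrite -natr1 in N0 *; rewrite !dotE. rewrite (dotC dot gN d).
move: (dot d d) (dot d gN) (dot gN gN) (dot yn _) (dot y0 _) => a b c e f.
move: (n%:R) N0 => m N0 h1 h2 h3; nra.
Qed.

End Sufficiency.

(** * Necessity of the certificates *)

Section WorstCase.
Variables (R : realType) (n : nat).
Local Notation X := (euclid R n.+1).
Implicit Types x y u v w : X.
Local Notation edotX := (@edot R n.+1 : {dot X for @idfun R}).

(** Multiplication by z modulo z^N + 1 on coefficient vectors; [dshift] is then multiplication by z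
    - 1 and [dpow m] by (z - 1)^m. *)
Definition negashift x : X :=
  \row_i (if unlift ord0 i is Some j then coor x (widen_ord (leqnSn n) j)
          else - coor x ord_max).

Lemma negashift0 x : coor (negashift x) ord0 = - coor x ord_max.
Proof. by rewrite /coor mxE unlift_none. Qed.

Lemma negashiftS x i :
  coor (negashift x) (lift ord0 i) = coor x (widen_ord (leqnSn n) i).
Proof. by rewrite [LHS]mxE liftK. Qed.

Lemma negashift_linear : linear negashift.
Proof.
move=> a x y; apply: euclidP => i; case: (unliftP ord0 i) => [j|] ->.
  by rewrite negashiftS !(coorD, coorZ) !negashiftS.
by rewrite negashift0 !(coorD, coorZ) !negashift0; ring.
Qed.

HB.instance Definition _ := GRing.isLinear.Build R X X *:%R negashift
  negashift_linear.

Lemma edot_negashift x y : edot (negashift x) (negashift y) = edot x y.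
Proof.
rewrite /edot big_ord_recl [RHS]big_ord_recr/= !negashift0 mulrNN addrC.
by congr (_ + _); apply: eq_bigr => i _; rewrite !negashiftS.
Qed.

Definition dshift x : X := negashift x - x.

Lemma dshift_linear : linear dshift.
Proof. by move=> a x y; rewrite /dshift linearP scalerBr opprD addrACA. Qed.

HB.instance Definition _ := GRing.isLinear.Build R X X *:%R dshift
  dshift_linear.

Definition dpow (m : nat) x : X := iter m dshift x.

Lemma dpow_linear m : linear (dpow m).
Proof. by move=> a x y; elim: m => //= m ->; rewrite linearP. Qed.

HB.instance Definition _ m := GRing.isLinear.Build R X X *:%R (dpow m)
  (dpow_linear m).

Lemma edot_dshift x y :
  edot (dshift x) (dshift y) = - edot (dshift x) y - edot x (dshift y).
Proof. by rewrite /dshift !(dotE edotX)/= edot_negashift; ring. Qed.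

Lemma norm_negashift x : `|negashift x| = `|x|.
Proof.
by apply/eqP; rewrite -(@eqrXn2 _ 2)// !sqr_normE edot_negashift.
Qed.

Lemma norm_dpow m x : `|dpow m x| <= 2 ^+ m * `|x|.
Proof.
elim: m => [|m IH] /=; first by rewrite expr0 mul1r.
rewrite (le_trans (ler_normB _ _))// norm_negashift exprS -mulrA mulr_natl mulr2n.
exact: lerD.
Qed.

Definition unit0 : X := \row_i (i == ord0)%:R.
Definition ones : X := const_mx 1.
(** The inverse of 1 - z modulo z^N + 1. Its squared norm N / 4 makes the optimal bound on the
    squared final residual equal to 1 / N. *)
Definition wstart : X := 2^-1 *: ones.

Lemma coor_unit0 i : coor unit0 i = (i == ord0)%:R.
Proof. by rewrite [LHS]mxE. Qed.

Lemma coor_ones i : coor ones i = 1.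
Proof. by rewrite [LHS]mxE. Qed.

Lemma edot_ones x : edot x ones = \sum_i coor x i.
Proof. by apply: eq_bigr => i _; rewrite coor_ones mulr1. Qed.

Lemma edot_ones_ones : edot ones ones = n.+1%:R.
Proof.
rewrite edot_ones (eq_bigr (fun=> 1)) => [|i _]; last exact: coor_ones.
by rewrite sumr_const card_ord.
Qed.

Lemma sqr_norm_wstart : `|wstart| ^+ 2 = n.+1%:R / 4.
Proof. by rewrite sqr_normE !(dotE edotX)/= edot_ones_ones; field. Qed.

Lemma dshift_wstart : dshift wstart = - unit0.
Proof.
apply: euclidP => i; rewrite -scaleN1r coorZ coor_unit0 coorB.
case: (unliftP ord0 i) => [j|] ->.
  by rewrite negashiftS !coorZ !coor_ones /=; ring.
by rewrite negashift0 !coorZ !coor_ones eqxx /=; field.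
Qed.

Lemma dpowSr m x : dpow m.+1 x = dpow m (dshift x).
Proof. exact: iterSr. Qed.

Lemma dpow_wstart m : dpow m.+1 wstart = - dpow m unit0.
Proof. by rewrite dpowSr dshift_wstart linearN. Qed.

(** The binomial expansion of (z - 1)^m, whose degree is too small to wrap around. *)
Lemma coor_dpow_unit0 m i : (m <= n)%N ->
  coor (dpow m unit0) i = (-1) ^+ (m + i) * 'C(m, i)%:R.
Proof.
elim: m i => [|m IH] i mn.
  rewrite coor_unit0 add0n bin0n; case: (unliftP ord0 i) => [j|] -> /=.
    by rewrite mulr0.
  by rewrite expr0 mul1r.
rewrite [dpow _ _]/= coorB; case: (unliftP ord0 i) => [j|] ->.
  rewrite negashiftS !IH ?(ltnW mn)//= /bump/= !add1n binS natrD !addnS !addSn !exprS; ring.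
rewrite negashift0 !IH ?(ltnW mn)//= !bin0 bin_small// mulr0 oppr0 !addn0 exprS !mulr1.
ring.
Qed.

Lemma edot_dpow l m : (l <= n)%N -> (m <= n)%N ->
  edot (dpow l unit0) (dpow m unit0) = pascal R l m.
Proof.
have base k : (k <= n)%N -> edot (dpow k unit0) unit0 = pascal R k 0.
  move=> kn; rewrite /edot big_ord_recl big1 => [|i _].
    by rewrite coor_dpow_unit0// coor_unit0 pascal0 bin0 !mulr1 addr0 addn0.
  by rewrite coor_unit0 mulr0.
elim: l m => [|l IHl] m ln mn; first by rewrite edotC base// pascalC.
elim: m mn => [|m IHm] mn; first by rewrite base.
rewrite edot_dshift -![dshift (dpow _ _)]/(dpow _.+1 _) IHm ?(ltnW mn)//.
rewrite IHl ?(ltnW ln)//; have := pascalSS R l m; lra.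
Qed.

(** Pairing with [ones] evaluates a polynomial at z = 1. *)
Lemma edot_dpow_ones m : (m <= n)%N ->
  edot (dpow m unit0) ones = (m == 0%N)%:R.
Proof.
case: m => [|m] mn.
  rewrite edot_ones big_ord_recl big1 => [|i _]; last by rewrite coor_unit0.
  by rewrite coor_unit0 addr0.
rewrite !edot_ones [dpow _ _]/=.
under eq_bigr do rewrite coorB.
rewrite sumrB big_ord_recl [X in _ - X]big_ord_recr/= negashift0.
under eq_bigr do rewrite negashiftS.
have -> : coor (dpow m unit0) ord_max = 0.
  by rewrite coor_dpow_unit0 ?(ltnW mn)//= bin_small// mulr0.
ring.
Qed.

(** The pairings with m >= 1 form a triangular system with diagonal entries of absolute value 1 in
    the first [n] coordinates; the pairing with [wstart] itself then settles the last coordinate. *)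
Lemma dpow_wstart_total z :
  (forall m, (m <= n)%N -> edot (dpow m wstart) z = 0) -> z = 0.
Proof.
move=> h.
have z0 (i : nat) : forall j : 'I_n.+1, (j < n)%N -> j = i :> nat -> coor z j = 0.
  elim/ltn_ind: i => i IH j jn ji.
  have := h i.+1; rewrite -ji => /(_ jn); rewrite dpow_wstart (dotE edotX)/= => /eqP.
  rewrite oppr_eq0 /edot (bigD1 j)//= big1 => [|k kj].
    rewrite addr0 coor_dpow_unit0 ?(ltnW jn)// binn mulr1 mulf_eq0 signr_eq0.
    by move/eqP.
  rewrite coor_dpow_unit0 ?(ltnW jn)//; have [kj'|jk] := ltnP k j.
    by rewrite (IH k) ?mulr0// -?ji//; exact: ltn_trans jn.
  by rewrite bin_small ?mulr0 ?mul0r// ltn_neqAle jk eq_sym andbT.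
apply: euclidP => i; rewrite coor0.
case: (widen_or_max i) => [->|[j ->]]; last by apply: (z0 j) => //; exact: (ltn_ord j).
have := h 0%N (leq0n n); rewrite /= (dotE edotX)/= edotC edot_ones big_ord_recr/=.
rewrite big1 => [/eqP|j _]; last by apply: (z0 j) => //; exact: (ltn_ord j).
by rewrite add0r mulf_eq0 invr_eq0 pnatr_eq0 => /eqP.
Qed.

End WorstCase.

(** * Iterates of the algorithm on the shift, and their perturbations *)

Section WorstIterates.
Variables (R : realType) (n : nat) (H : 'M[R]_n).
Hypothesis Htrig : is_trig_mx H.
Local Notation X := (euclid R n.+1).
Local Notation edotX := (@edot R n.+1 : {dot X for @idfun R}).
Local Notation C := (stepmx H).
Local Notation N := n.+1.

(** The Neumann series for x = s + C (z - 1) x, finite because C is nilpotent. *)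
Definition solve (s : 'I_N -> X) (a : 'I_N) : X :=
  \sum_(m < N) dpow m (\sum_b (C ^+ m) a b *: s b).

Lemma solveE s a : solve s a = s a + \sum_b C a b *: dshift (solve s b).
Proof.
pose S m a := \sum_b (C ^+ m) a b *: s b.
have SS m c : S m.+1 c = \sum_b C c b *: S m b.
  under [RHS]eq_bigr do rewrite scaler_sumr.
  rewrite exchange_big; apply: eq_bigr => b _ /=; rewrite exprS mxE scaler_suml.
  by apply: eq_bigr => d _; rewrite scalerA.
have S0 : S 0%N a = s a.
  rewrite /S expr0 (bigD1 a)//= big1 => [|b /negPf ba].
    by rewrite mxE eqxx scale1r addr0.
  by rewrite mxE eq_sym ba scale0r.
have SN : S N a = 0 by rewrite /S stepmx_nilp// big1// => b _; rewrite mxE scale0r.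
transitivity (\sum_(m < N.+1) dpow m (S m a)).
  rewrite big_ord_recr -[X in _ = _ + X]/(dpow N (S N a)) SN.
  by rewrite [X in _ + X]linear0 addr0.
rewrite big_ord_recl/= S0; congr (_ + _).
under [RHS]eq_bigr do rewrite linear_sum scaler_sumr.
rewrite exchange_big; apply: eq_bigr => m _ /=.
rewrite -[LHS]/(dpow m.+1 (S m.+1 a)) SS linear_sum.
by apply: eq_bigr => b _; rewrite linearZ.
Qed.

Definition worst_iterate : 'I_N -> X := solve (fun=> wstart R n).

Lemma worst_iterateE a :
  worst_iterate a = \sum_(m < N) prow H m 0 a *: dpow m (wstart R n).
Proof.
apply: eq_bigr => m _; rewrite -scaler_suml linearZ/=; congr (_ *: _).
by rewrite /prow mxE [RHS]mxE; apply: eq_bigr => b _; rewrite mxE mulr1.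
Qed.

(** The amount by which the iterates decrease when [u] is added to the residual at node [k]. *)
Definition response (k : 'I_N) (u : X) : 'I_N -> X :=
  solve (fun b => C b k *: u).

Lemma responseE k u a :
  response k u a = \sum_(m < N) (C ^+ m.+1) a k *: dpow m u.
Proof.
apply: eq_bigr => m _; rewrite -linearZ/=; congr (dpow _ _).
rewrite exprSr mxE scaler_suml; apply: eq_bigr => b _; exact: scalerA.
Qed.

Lemma response_le (k : 'I_N) u (a : 'I_N) : (a <= k)%N -> response k u a = 0.
Proof.
move=> ak; rewrite responseE big1// => m _.
by rewrite stepmx_exp_lower ?scale0r// addnS ltnS (leq_trans ak)// leq_addr.
Qed.

Definition response_bound (k a : 'I_N) : R :=
  \sum_(m < N) `|(C ^+ m.+1) a k| * 2 ^+ m.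

Lemma response_bound_ge0 k a : 0 <= response_bound k a.
Proof. by apply: sumr_ge0 => m _; rewrite mulr_ge0// exprn_ge0. Qed.

Lemma norm_response k u a : `|response k u a| <= response_bound k a * `|u|.
Proof.
rewrite responseE (le_trans (ler_norm_sum _ _ _))// mulr_suml ler_sum// => m _.
by rewrite normrZ -mulrA ler_wpM2l// norm_dpow.
Qed.

Lemma solveB s t a : solve (fun b => s b - t b) a = solve s a - solve t a.
Proof.
rewrite -sumrB; apply: eq_bigr => m _; rewrite -linearB -sumrB/=.
by congr (dpow _ _); apply: eq_bigr => b _; rewrite scalerBr.
Qed.

Definition perturbed (k : 'I_N) (u : X) (a : 'I_N) : X :=
  worst_iterate a - response k u a.

Lemma stepmx_row0 b : C ord0 b = 0.
Proof. by rewrite stepmx_lower. Qed.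

Lemma perturbed0 k u : perturbed k u ord0 = wstart R n.
Proof.
rewrite /perturbed response_le// subr0 /worst_iterate solveE big1 ?addr0// => b _.
by rewrite stepmx_row0 scale0r.
Qed.

Lemma perturbedE k u a : perturbed k u a = wstart R n -
  \sum_b C a b *: (- dshift (perturbed k u b) + (b == k)%:R *: u).
Proof.
rewrite {1}/perturbed /worst_iterate /response -solveB solveE -addrA; congr (_ + _).
under [in RHS]eq_bigr do rewrite scalerDr scalerN.
rewrite big_split/= sumrN opprD opprK addrC; congr (_ + _).
  by apply: eq_bigr => b _; rewrite solveB.
congr (- _); rewrite (bigD1 k)//= big1 => [|b /negPf bk]; last by rewrite bk scale0r scaler0.
by rewrite eqxx scale1r addr0.
Qed.

Lemma perturbed_generates k u (T : X -> X) :
    (forall a, perturbed k u a - T (perturbed k u a) =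
      - dshift (perturbed k u a) + (a == k)%:R *: u) ->
  @generates R N H X T (fun i => perturbed k u (inord i)).
Proof.
move=> TE; apply/(generates_stepmx _ _ Htrig) => a.
have -> : inord 0 = ord0 :> 'I_N by apply/val_inj; rewrite /= inordK.
rewrite inord_val perturbed0 {1}perturbedE; congr (_ - _).
by apply: eq_bigr => b _; rewrite inord_val TE.
Qed.

Lemma dshift_worst a :
  - dshift (worst_iterate a) = \sum_(m < N) prow H m 0 a *: dpow m (unit0 R n).
Proof.
rewrite worst_iterateE linear_sum -sumrN; apply: eq_bigr => m _.
by rewrite linearZ/= -[dshift _]/(dpow m.+1 _) dpow_wstart scalerN opprK.
Qed.

Hypothesis Hopt : @Hstar R N H.

Lemma negashift_nonexpansive : nonexpansive (@negashift R n).
Proof. by move=> x y; rewrite -linearB norm_negashift. Qed.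

(** Evaluating at z = 1 gives <g, ones> = 1, while optimality gives |g|^2 <= 1 / N; this is the
    equality case of Cauchy-Schwarz. *)
Lemma worst_final : - dshift (worst_iterate ord_max) = N%:R^-1 *: ones R n.
Proof.
set g := - dshift _.
have N0 : (N%:R : R) != 0 by rewrite pnatr_eq0.
have pE a : perturbed ord0 0 a = worst_iterate a.
  rewrite /perturbed responseE big1 ?subr0// => m _.
  by rewrite linear0 scaler0.
have [_ /(_ _ _ (@euclid_hilbert R N) (@negashift R n) 0
    (fun i => perturbed ord0 0 (inord i)) negashift_nonexpansive)] := Hopt.
have -> : inord 0 = ord0 :> 'I_N by apply/val_inj; rewrite /= inordK.
have -> : inord N.-1 = ord_max :> 'I_N by apply/val_inj; rewrite /= inordK.
rewrite linear0 => /(_ erefl) h.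
have {h}/h : @generates R N H X (@negashift R n) (fun i => perturbed ord0 0 (inord i)).
  by apply: perturbed_generates => a; rewrite scaler0 addr0 opprB.
rewrite perturbed0 subr0 sqr_norm_wstart pE -opprB -/(dshift _) -/g => gle.
have gones : edot g (ones R n) = 1.
  rewrite /g dshift_worst (dot_suml edotX) (bigD1 ord0)// big1 => [|m /= m0].
    by rewrite (dotZl edotX) [X in _ * X]edot_dpow_ones// prow0 /= mxE addr0 mulr1.
  rewrite (dotZl edotX) [X in _ * X]edot_dpow_ones -1?ltnS//.
  by move: m0; rewrite -val_eqE => /negPf/= ->; rewrite mulr0.
clearbody g; apply/eqP.
rewrite -subr_eq0 -normr_eq0 -sqrf_eq0 eq_le sqr_ge0 andbT.
rewrite sqr_normE !(dotE edotX)/= (edotC (ones R n)) gones.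
rewrite edot_ones_ones -sqr_normE; move: (N%:R : R) N0 gle => r r0 gle.
have e : 4 * (r / 4) / r ^+ 2 = r^-1 by field.
rewrite e in gle.
have rr : r^-1 * (r^-1 * r) = r^-1 by rewrite mulVf ?mulr1.
lra.
Qed.

Lemma invariant_max : invariant H n != 0.
Proof.
have := congr1 (fun u => coor u ord_max) worst_final.
rewrite dshift_worst coorZ coor_ones mulr1 => e.
suff <- : N%:R^-1 = invariant H n by rewrite invr_eq0 pnatr_eq0.
rewrite -e coor_sum (bigD1 ord_max)// big1 => [|m /= mn].
  rewrite coorZ coor_dpow_unit0//= binn mulr1 addr0.
  by rewrite addnn -mul2n exprM sqrrN !expr1n mulr1.
rewrite coorZ coor_dpow_unit0 -1?ltnS// bin_small ?mulr0//.
by rewrite ltn_neqAle -ltnS ltn_ord andbT.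
Qed.

(** Both sides are the pairing of (z - 1)^l with the final residual, once expanded in powers of z -
    1 and once in its forced value [ones] / N. *)
Lemma Hstar_balanced : balanced H.
Proof.
move=> l ln; transitivity (edot (dpow l (unit0 R n)) (- dshift (worst_iterate ord_max))).
  rewrite dshift_worst (dot_sumr edotX); apply: eq_bigr => m _.
  have mn : (m <= n)%N by rewrite -ltnS.
  rewrite (dotZr edotX) [X in _ = _ * X](edot_dpow _ ln mn) mulrC.
  by rewrite /invariant.
by rewrite worst_final (dotZr edotX)/= edot_dpow_ones// mulrC.
Qed.

(** Orthogonality to all iterates is preserved by applying C, which shifts the powers in [prow] by
    any r ([hb]). At the last node with r = n - m, smaller indices vanish by induction and larger
    ones by nilpotency; the surviving coefficient is [invariant H n], which is nonzero. *)
Lemma worst_iterate_total z : (forall a, edot (worst_iterate a) z = 0) -> z = 0.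
Proof.
move=> h; apply: dpow_wstart_total.
pose b (m : nat) : R := edot (dpow m (wstart R n)) z.
have hb (r : nat) a : \sum_(m < N) prow H (m + r) 0 a * b m = 0.
  elim: r a => [|r IH] a.
    transitivity (edot (worst_iterate a) z) => //.
    rewrite worst_iterateE (dot_suml edotX)/=.
    by apply: eq_bigr => m _; rewrite addn0 (dotZl edotX).
  under eq_bigr do rewrite addnS prowSE mulr_suml.
  rewrite exchange_big big1//= => c _.
  transitivity (C a c * \sum_(m < N) prow H (m + r) 0 c * b m).
    by rewrite mulr_sumr; apply: eq_bigr => m _; ring.
  by rewrite IH mulr0.
move=> m; elim/ltn_ind: m => m IH mn; rewrite -/(b m).
have := hb (n - m)%N ord_max; rewrite (bigD1 (Ordinal (mn : m < N)%N))//= big1 => [|i im].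
  rewrite addr0 subnKC// => /eqP; rewrite mulf_eq0.
  by rewrite (negPf invariant_max) => /eqP.
have [iltm|mi] := ltnP i m; first by rewrite /b IH ?mulr0// -ltnS.
rewrite prow_nilp ?mxE ?mul0r//; move: im; rewrite -val_eqE/=; lia.
Qed.

(** The N iterates form a basis, so a half-space normal can be chosen with prescribed pairings. *)
Lemma worst_iterate_dual (t : 'I_N -> R) :
  exists z, forall a, edot (worst_iterate a) z = t a.
Proof.
pose A : 'M[R]_N := \matrix_(a, i) coor (worst_iterate a) i.
have Aunit : A^T \in unitmx.
  rewrite -row_free_unit; apply: inj_row_free => v vA.
  apply: (@worst_iterate_total v) => a.
  have e : (v *m A^T) 0 a = 0 by rewrite vA mxE.
  rewrite -e [RHS]mxE; apply: eq_bigr => i _.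
  by rewrite [A^T _ _]mxE [A _ _]mxE mulrC.
exists ((\row_a t a) *m invmx A^T) => a.
have e : ((\row_a t a) *m invmx A^T *m A^T) 0 a = t a by rewrite mulmxKV// mxE.
rewrite -e [RHS]mxE; apply: eq_bigr => i _.
by rewrite [A^T _ _]mxE [A _ _]mxE mulrC.
Qed.

End WorstIterates.

(** * Folding along a hyperplane *)

Section Fold.
Variables (R : realType) (n : nat).
Local Notation X := (euclid R n).
Local Notation edotX := (@edot R n : {dot X for @idfun R}).
Implicit Types x y z : X.

Definition pos (a : R) : R := Num.max 0 a.

Lemma pos_ge0 a : 0 <= pos a.
Proof. by rewrite le_max lexx. Qed.

Lemma posB a : pos a - pos (- a) = a.
Proof.
rewrite /pos; have [a0|a0] := leP 0 a.
  by rewrite max_l ?subr0// oppr_le0.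
by rewrite max_r ?sub0r ?opprK// oppr_ge0 ltW.
Qed.

Lemma posM a : pos a * pos (- a) = 0.
Proof.
rewrite /pos; have [a0|a0] := leP 0 a.
  by rewrite (max_l (_ : - a <= 0)) ?mulr0// oppr_le0.
by rewrite mul0r.
Qed.

Lemma pos_id a : 0 <= a -> pos a = a.
Proof. exact: max_r. Qed.

Lemma pos_eq0 a : a <= 0 -> pos a = 0.
Proof. exact: max_l. Qed.

(* Reflects the half-space [edot x z > 0] onto the opposite one. *)
Definition fold z x : X := x - (2 * pos (edot x z) / edot z z) *: z.

(** The loss is nonzero only for points strictly on opposite sides of the hyperplane; this is what
    singles out pairs of iterates. *)
Lemma sqr_dist_fold z x y : z != 0 ->
  edot (fold z x - fold z y) (fold z x - fold z y) = edot (x - y) (x - y) -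
  4 / edot z z * (pos (edot x z) * pos (- edot y z) +
                  pos (- edot x z) * pos (edot y z)).
Proof.
move=> z0; have nu0 : edot z z != 0 by rewrite gt_eqF// edot_gt0.
rewrite /fold; set a := edot x z; set b := edot y z.
set c := 2 * _ / _; set d := 2 * _ / _.
have -> : x - c *: z - (y - d *: z) = (x - y) - (c - d) *: z.
  by apply: euclidP => i; rewrite !(coorB, coorZ); ring.
have -> : edot (x - y - (c - d) *: z) (x - y - (c - d) *: z) =
    edot (x - y) (x - y) - 2 * (c - d) * (a - b) + (c - d) ^+ 2 * edot z z.
  have -> : a - b = edot (x - y) z by rewrite (dotDl edotX) (dotNl edotX).
  move: (x - y) => v; rewrite !(dotE edotX)/= (edotC z v); ring.
rewrite -addrA; congr (_ + _).
have := posM a; have := posM b; have := posB a; have := posB b.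
rewrite /c /d; move: (pos a) (pos b) (pos (- a)) (pos (- b)) => pa pb na nb.
move=> <- <- h1 h2; move: (edot z z) nu0 => nu nu0.
transitivity (4 / nu * (pa * na + pb * nb) - 4 / nu * (pa * nb + na * pb)).
  by field.
by rewrite h1 h2 addr0 mulr0 sub0r.
Qed.

Lemma fold_nonexpansive z : z != 0 -> nonexpansive (fold z).
Proof.
move=> z0 x y; rewrite -(@ler_pXn2r _ 2) ?nnegrE// !sqr_normE sqr_dist_fold//.
rewrite lerBlDr lerDl mulr_ge0 ?divr_ge0 ?edot_ge0//.
by rewrite addr_ge0// mulr_ge0 ?pos_ge0.
Qed.

Lemma fold0 z : fold z 0 = 0.
Proof. by rewrite /fold (dot0l edotX) /pos maxxx mulr0 mul0r scale0r subr0. Qed.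

End Fold.

(** * Nonnegativity of the certificates of an optimal algorithm *)

Section GramSign.
Variables (R : realType) (n : nat) (H : 'M[R]_n).
Hypotheses (Htrig : is_trig_mx H) (Hopt : @Hstar R n.+1 H).
Local Notation X := (euclid R n.+1).
Local Notation edotX := (@edot R n.+1 : {dot X for @idfun R}).
Local Notation C := (stepmx H).
Local Notation N := n.+1.
Local Notation Nr := (n.+1%:R : R).

Lemma nonexpansive_gap (T : X -> X) x y :
  2 * edot (x - y) ((x - T x) - (y - T y)) -
    edot ((x - T x) - (y - T y)) ((x - T x) - (y - T y)) =
  edot (x - y) (x - y) - edot (T x - T y) (T x - T y).
Proof.
have -> : T x - T y = (x - y) - ((x - T x) - (y - T y)).
  by apply: euclidP => i; rewrite !coorB; ring.
move: (x - y) (x - T x - (y - T y)) => d e.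
rewrite !(dotE edotX)/= (edotC e d); ring.
Qed.

Section Perturbation.
Variables (j k : 'I_N) (e : R) (z : X).
Hypotheses (jk : (j < k)%N) (e0 : 0 < e).

Let K : R := \sum_a 2 * response_bound H k a.

(* The margin [K * e] absorbs the effect of the fold on the iterates after [k],
   so that [y k] is the only iterate in the folded half-space. *)
Hypothesis zE : forall a, edot (worst_iterate H a) z =
  if a == k then e else if a == j then - 1 else - (K * e).

Let nu := edot z z.
(** The fold moves [y k] by -(2e / nu) z; after the shift, this is what its residual gains. *)
Let u : X := (2 * e / nu) *: negashift z.
Let y := perturbed H k u.
Let T x := negashift (fold z x).

Let z0 : z != 0.
Proof.
apply/eqP => zz; have := zE k; rewrite eqxx zz (dotC edotX) (dot0l edotX).
by move=> e1; have := e0; rewrite -e1 ltxx.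
Qed.

Let nu0 : 0 < nu. Proof. exact: edot_gt0. Qed.

Let norm_u : `|u| = 2 * e / nu * `|z|.
Proof.
rewrite normrZ norm_negashift ger0_norm// divr_ge0 ?(ltW nu0)//.
by rewrite mulr_ge0// ltW.
Qed.

Let K_ge a : 2 * response_bound H k a <= K.
Proof.
rewrite /K (bigD1 a)//= lerDl sumr_ge0// => b _.
by rewrite mulr_ge0// response_bound_ge0.
Qed.

Let yz_close a : `|edot (y a) z - edot (worst_iterate H a) z| <= K * e.
Proof.
rewrite /y /perturbed (dotDl edotX) (dotNl edotX)/= addrAC subrr add0r normrN.
rewrite (le_trans (normr_edot _ _))//.
apply: (@le_trans _ _ (response_bound H k a * `|u| * `|z|)).
  by rewrite ler_wpM2r// norm_response.
(* Here |u| |z| = 2e, so the dependence on the size of [z] cancels. *)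
rewrite norm_u; have -> : response_bound H k a * (2 * e / nu * `|z|) * `|z| =
    2 * response_bound H k a * e.
  have : `|z| ^+ 2 = nu by rewrite sqr_normE.
  move=> <-; have zn : `|z| != 0 by rewrite normr_eq0.
  by field.
by rewrite ler_wpM2r// ltW.
Qed.

Let yk : edot (y k) z = e.
Proof. by rewrite /y /perturbed response_le// subr0 zE eqxx. Qed.

Let yj : edot (y j) z = - 1.
Proof.
rewrite /y /perturbed response_le ?(ltnW jk)// subr0 zE eqxx.
by rewrite -val_eqE/= ltn_eqF.
Qed.

Let y_neg a : a != k -> edot (y a) z <= 0.
Proof.
move=> ak; have := yz_close a; rewrite zE (negPf ak).
case: eqP => [->|_ /ler_normlP[_]]; first by rewrite yj.
by rewrite opprK; lra.
Qed.

Let y_small a : a != j -> pos (- edot (y a) z) <= 2 * K * e.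
Proof.
have Ke : 0 <= K * e by apply: le_trans (yz_close a).
move=> aj; have := yz_close a; rewrite zE (negPf aj); case: eqP => [->|_].
  by rewrite yk pos_eq0 ?oppr_le0 ?(ltW e0)// => _; lra.
move=> /ler_normlP[h _]; rewrite /pos ge_max; apply/andP; split; lra.
Qed.

(** Consistency of the construction: only [y k] lies in the folded half-space, so the perturbed
    iterates are a genuine trajectory of [T]. *)
Let TE a : y a - T (y a) = - dshift (y a) + (a == k)%:R *: u.
Proof.
rewrite /T /fold linearB linearZ/= opprB addrCA opprB [RHS]addrC; congr (_ + _).
have [->|ak] := eqVneq a k; first by rewrite yk pos_id ?(ltW e0)// scale1r.
by rewrite pos_eq0 ?y_neg// mulr0 mul0r !scale0r.
Qed.

Let residual :
  `|y ord_max - T (y ord_max) - Nr^-1 *: ones R n| ^+ 2 * nu <=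
  (2 * response_bound H k ord_max + 1) ^+ 2 * (4 * e ^+ 2).
Proof.
rewrite -(worst_final Htrig Hopt) TE.
set c := response_bound H k ord_max.
have c0 : 0 <= c by exact: response_bound_ge0.
have -> : - dshift (y ord_max) + (ord_max == k)%:R *: u - - dshift (worst_iterate H ord_max) =
    dshift (response H k u ord_max) + (ord_max == k)%:R *: u.
  rewrite /y /perturbed (linearB (@dshift R n))/= opprB opprK addrAC; congr (_ + _).
  by rewrite subrK.
have : `|dshift (response H k u ord_max) + (ord_max == k)%:R *: u| <= (2 * c + 1) * `|u|.
  rewrite (le_trans (ler_normD _ _))// mulrDl lerD//.
    apply: le_trans (norm_dpow 1 _) _; rewrite expr1 -mulrA ler_wpM2l//.
    exact: norm_response.
  by rewrite normrZ ler_wpM2r//; case: eqP; rewrite ?normr1 ?normr0.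
move: (dshift _ + _) => r h.
have h2 : `|r| ^+ 2 * nu <= ((2 * c + 1) * `|u|) ^+ 2 * nu.
  by rewrite ler_wpM2r ?(ltW nu0)// ler_pXn2r ?nnegrE// mulr_ge0// addr_ge0// mulr_ge0.
have zz : `|z| ^+ 2 = nu by rewrite sqr_normE.
have un : `|u| ^+ 2 * nu = 4 * e ^+ 2.
  by rewrite norm_u exprMn zz; field; rewrite gt_eqF.
by rewrite (le_trans h2)// exprMn -mulrA un.
Qed.

(** In the certificate identity for [T] only pairs containing k lose distance, so the left side is
    of first order in e. Optimality and the closeness of the final residual to [ones] / N make the
    right side of second order. *)
Let sum_gram_pos : \sum_b gram H k b * pos (- edot (y b) z) <=
  2^-1 * (2 * response_bound H k ord_max + 1) ^+ 2 * e.
Proof.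
have Hbal := Hstar_balanced Htrig Hopt.
pose g a := y a - T (y a).
have yE a : y a = wstart R n - \sum_b C a b *: g b.
  rewrite [LHS](perturbedE Htrig); congr (_ - _); apply: eq_bigr => b _.
  by rewrite /g TE.
have := certificate_identity Htrig Hbal edotX yE.
pose p a := pos (edot (y a) z); pose q a := pos (- edot (y a) z).
pose f a b := - (Nr * gram H a b) * (4 / nu * (p a * q b + q a * p b)).
rewrite (eq_bigr (fun a : 'I_N => \sum_(b < N | (b < a)%N) f a b)); last first.
  move=> a _; apply: eq_bigr => b _; rewrite /f [X in _ * X]nonexpansive_gap.
  rewrite -[T (y a) - _]linearB edot_negashift sqr_dist_fold//; congr (_ * _).
  by rewrite -/nu /p /q; ring.
have fC a b : f a b = f b a by rewrite /f gram_sym; ring.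
have f0 a : f a a = 0.
  by rewrite /f /p /q [X in _ + X]mulrC posM addr0 !mulr0.
have := sum_lt_sym fC f0; set S := (X in 2 * X = _).
pose A := \sum_b gram H k b * q b; rewrite -/A.
have p0 a : a != k -> p a = 0 by move=> ak; rewrite /p pos_eq0// y_neg.
have pk : p k = e by rewrite /p yk pos_id// ltW.
have -> : \sum_a \sum_b f a b = - (8 * Nr * e / nu) * A.
  have E a b : f a b = - (4 * Nr / nu) * (p a * (gram H a b * q b)) +
      - (4 * Nr / nu) * (p b * (gram H b a * q a)).
    by rewrite /f (gram_sym H b a); ring.
  have half : \sum_a p a * (\sum_b gram H a b * q b) = e * A.
    rewrite (bigD1 k)//= [X in _ + X]big1 ?addr0 ?pk// => a ak.
    by rewrite p0// mul0r.
  under eq_bigr do under eq_bigr do rewrite E.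
  under eq_bigr do rewrite big_split/=.
  rewrite big_split/= [X in _ + X]exchange_big/=.
  under eq_bigr do rewrite -!mulr_sumr.
  by rewrite -!mulr_sumr !half; field; rewrite gt_eqF.
move=> SA SE.
have [_ opt] := Hopt.
have {opt} gle : edot (g ord_max) (g ord_max) <= Nr^-1.
  have Tne : nonexpansive T.
    move=> v w; rewrite /T -linearB norm_negashift; exact: fold_nonexpansive.
  have T0 : T 0 = 0 by rewrite /T fold0 linear0.
  have := opt X edotX (@euclid_hilbert R N) T 0 (fun i => y (inord i)) Tne T0
    (perturbed_generates Htrig TE).
  have -> : inord 0 = ord0 :> 'I_N by apply/val_inj; rewrite /= inordK.
  have -> : inord N.-1 = ord_max :> 'I_N by apply/val_inj; rewrite /= inordK.
  have -> : y ord0 = wstart R n := perturbed0 Htrig k u.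
  rewrite subr0 sqr_norm_wstart sqr_normE => /le_trans; apply.
  have : Nr != 0 by rewrite pnatr_eq0.
  by move: Nr => r r0; rewrite le_eqVlt; apply/orP; left; apply/eqP; field.
(* The shift and the fold both preserve the distance to the fixed point 0, so this inequality holds
   with equality. *)
have fixed : 2 * edot (y ord_max) (g ord_max) = edot (g ord_max) (g ord_max).
  have := nonexpansive_gap T (y ord_max) 0.
  have -> : T 0 = 0 by rewrite /T fold0 linear0.
  rewrite !subr0 -/(g ord_max) /T edot_negashift.
  have := sqr_dist_fold (y ord_max) 0 z0.
  rewrite fold0 !subr0 (dot0l edotX) oppr0 /pos maxxx !mulr0 addr0 mulr0 subr0 => ->.
  by rewrite subrr => /subr0_eq.
have := residual; rewrite -/(g ord_max) sqr_normE.
move: (g ord_max) (y ord_max) SE gle fixed => gN yN SE gle fixed.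
rewrite !(dotE edotX)/= edot_ones_ones (edotC (ones R n)) => res.
move: SE; rewrite (dotDl edotX) (dotNl edotX) (dotZl edotX)/= (edotC (ones R n)) => SE.
set B := (2 * _ + 1) ^+ 2 in res *.
move: (edot gN gN) (edot gN (ones R n)) (edot yN gN) SE gle fixed res => G o yg SE gle fixed res.
have N0 : 0 < Nr by rewrite ltr0n.
have NE : n%:R = Nr - 1 by rewrite -natr1 addrK.
rewrite NE in SE; clear NE; move: Nr N0 SE gle res SA => r r0 SE gle res SA.
have rG : r * G <= 1 by rewrite mulrC -ler_pdivlMr// div1r.
(* The bracket is N / 2 times the squared distance from g_N to [ones] / N. By [rG] it dominates r G
   - o, the value that the certificate identity produces. *)
have {}res : nu * (r * G / 2 - o + 2^-1) <= 2 * r * B * e ^+ 2.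
  have -> : nu * (r * G / 2 - o + 2^-1) = r / 2 * ((G - r^-1 * o +
     (- (r^-1 * o) - - (r^-1 * (r^-1 * r)))) * nu) by field; rewrite gt_eqF.
  have -> : 2 * r * B * e ^+ 2 = r / 2 * (B * (4 * e ^+ 2)) by field.
  by rewrite ler_wpM2l// divr_ge0// ltW.
have AE : A * (4 * r * e) = nu * (r * G - o).
  have -> : r * G - o = - S by rewrite [S]SE; lra.
  have -> : S = (2 * S) / 2 by field.
  by rewrite SA; field; rewrite gt_eqF.
have re0 : 0 < 4 * r * e by rewrite !mulr_gt0.
rewrite -(ler_pM2r re0) AE.
have -> : 2^-1 * B * e * (4 * r * e) = 2 * r * B * e ^+ 2 by field.
apply: le_trans res; rewrite ler_wpM2l ?(ltW nu0)//; lra.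
Qed.

(** In [sum_gram_pos] the node j has weight 1 and every other node has weight at most 2 K e. *)
Lemma gram_perturbation : gram H k j <=
  (2^-1 * (2 * response_bound H k ord_max + 1) ^+ 2 +
   (\sum_b `|gram H k b|) * (2 * K)) * e.
Proof.
have Ke : 0 <= 2 * K * e.
  have kj : k != j by rewrite -val_eqE/= gtn_eqF.
  exact: le_trans (pos_ge0 _) (y_small kj).
rewrite mulrDl -lerBlDr -(mulrA (\sum_b _)); apply: le_trans sum_gram_pos.
rewrite [leRHS](bigD1 j)//= yj opprK (pos_id ler01) mulr1 lerD2l lerNl -sumrN mulr_suml.
rewrite [leRHS](bigD1 j)//=.
apply: (@le_trans _ _ (\sum_(b | b != j) `|gram H k b| * (2 * K * e))).
  apply: ler_sum => b bj; rewrite -mulrN (le_trans (ler_norm _))// normrM normrN.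
  by rewrite ler_wpM2l// ger0_norm ?pos_ge0// y_small.
by rewrite lerDr mulr_ge0.
Qed.

End Perturbation.

Lemma Hstar_gram (a b : 'I_N) : (b < a)%N -> gram H a b <= 0.
Proof.
move=> ba; rewrite leNgt; apply/negP => g0.
set K : R := \sum_c 2 * response_bound H a c.
set B := 2^-1 * (2 * response_bound H a ord_max + 1) ^+ 2 +
   (\sum_c `|gram H a c|) * (2 * K).
have B0 : 0 <= B.
  apply: addr_ge0; first by apply: mulr_ge0; [rewrite invr_ge0|exact: sqr_ge0].
  rewrite mulr_ge0 ?sumr_ge0// mulr_ge0// sumr_ge0// => c _.
  by rewrite mulr_ge0// response_bound_ge0.
have B1 : 0 < B + 1 by rewrite ltr_wpDl.
(* [B] does not depend on e, so this choice of e makes [B * e] smaller than the entry it should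
   bound. *)
have e0 : 0 < gram H a b / (B + 1) by rewrite divr_gt0.
have [z zE] := worst_iterate_dual Htrig Hopt (fun c => if c == a then gram H a b / (B + 1)
  else if c == b then - 1 else - (K * (gram H a b / (B + 1)))).
have := gram_perturbation ba e0 zE; rewrite -/K -/B leNgt => /negP; apply.
rewrite mulrA ltr_pdivrMr// mulrC ltr_pM2l//; lra.
Qed.

End GramSign.

(** * Rooted forests *)

Section Forest.
Variables (N : nat) (f : nat -> nat).
Hypothesis f_gt : forall i, (1 <= i < N)%N -> (i < f i <= N)%N.
Hypothesis fN : f N = N.
Local Notation path_up i := (traject f i N).

Lemma f_range i : (1 <= i <= N)%N -> (1 <= f i <= N)%N.
Proof.
move=> /andP[i1]; rewrite leq_eqVlt => /orP[/eqP iN|iN].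
  by rewrite iN fN; lia.
by have := f_gt (introT andP (conj i1 iN)); lia.
Qed.

Lemma iter_f_range i m : (1 <= i <= N)%N -> (1 <= iter m f i <= N)%N.
Proof. by move=> iN; elim: m => //= m; exact: f_range. Qed.

Lemma iter_f_ge i m : (1 <= i <= N)%N -> (minn (i + m) N <= iter m f i)%N.
Proof.
move=> iN; elim: m => [|m IH]; first by rewrite addn0 geq_minl.
have /andP[r1 r2] := iter_f_range m iN; rewrite iterS.
move: r2; rewrite leq_eqVlt => /orP[/eqP->|r2]; first by rewrite fN geq_minr.
by have := f_gt (introT andP (conj r1 r2)); lia.
Qed.

(** The path is cut off after N entries, but N is reached within N - 1 steps, so one more entry adds
    no node. *)
Lemma path_up_cons i v : (1 <= i <= N)%N ->
  (v \in path_up i) = (v == i) || (v \in path_up (f i)).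
Proof.
move=> iN; have iterN m : (N.-1 <= m)%N -> iter m f i = N.
  move=> mN; have := iter_f_ge m iN; have := iter_f_range m iN; lia.
have E : v \in traject f i N.+1 = (v \in path_up i).
  rewrite trajectSr mem_rcons in_cons iterN; last by lia.
  case: eqP => //= ->; apply/esym/trajectP; exists N.-1; last by rewrite iterN.
  by lia.
by rewrite -E trajectS in_cons.
Qed.

Lemma path_up_last v : (1 <= N)%N -> (v \in path_up N) = (v == N).
Proof.
move=> N1; apply/trajectP/eqP => [[m _ ->]|->]; last by exists 0%N.
by elim: m => //= m ->.
Qed.

Lemma path_up_self i : (1 <= i <= N)%N -> i \in path_up i.
Proof. by move=> iN; rewrite path_up_cons// eqxx. Qed.

Lemma path_up_ge i v : (1 <= i <= N)%N -> v \in path_up i -> (i <= v <= N)%N.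
Proof.
move=> iN /trajectP[m _ ->]; have /andP[_ ->] := iter_f_range m iN.
rewrite andbT (leq_trans _ (iter_f_ge m iN))// leq_min leq_addr.
by case/andP: iN.
Qed.

(** The witness is the last node of the path not exceeding m. *)
Lemma path_up_over i m v : (1 <= i <= m)%N -> (m < v <= N)%N ->
    v \in path_up i ->
  exists a, [/\ (1 <= a <= m)%N, (m < f a)%N & (f a <= v)%N].
Proof.
move: {2}(v - i)%N (leqnn (v - i)%N) => d; elim: d i => [|d IH] i di im mv vi.
  by lia.
have fi : (i < f i <= N)%N by apply: f_gt; lia.
move: vi; rewrite path_up_cons; last by lia.
case: eqP => [|_ /= vfi]; first by lia.
have := path_up_ge (f_range (_ : (1 <= i <= N)%N)) vfi.
case: (ltnP m (f i)) => mfi; first by move=> h; exists i; split; lia.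
by move=> _; apply: (IH (f i)) => //; lia.
Qed.

Hypothesis no_crossing : forall a b, (1 <= a)%N -> (a < b)%N -> (b < f a)%N ->
  (f a < f b)%N -> (b < N)%N -> False.

(** If the arc of m overshot v, the arc of the path from i that jumps over m would end at most at v
    and hence cross it. *)
Lemma descendants_interval i m v : (1 <= i <= m)%N -> (m <= v <= N)%N ->
  v \in path_up i -> v \in path_up m.
Proof.
move: {2}(v - m)%N (leqnn (v - m)%N) => d; elim: d m => [|d IH] m dm im mv vi.
  by have -> : m = v; [lia|apply: path_up_self; lia].
have [->|mv'] := eqVneq m v; first by apply: path_up_self; lia.
have fm : (m < f m <= N)%N by apply: f_gt; lia.
rewrite path_up_cons; last by lia.
apply/orP; right; case: (leqP (f m) v) => [fmv|vfm].
  by apply: (IH (f m)) => //; lia.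
have [|a [a1 a2 a3]] := path_up_over im _ vi; first by lia.
have [am|am] := eqVneq a m; first by rewrite am in a3; lia.
by exfalso; apply: (@no_crossing a m); lia.
Qed.

Definition lowest v := \big[minn/v]_(1 <= j < N.+1 | v \in path_up j) j.

Lemma lowest_path v : (1 <= v <= N)%N -> v \in path_up (lowest v).
Proof.
move=> vN; rewrite /lowest; apply: (big_rec (fun j => v \in path_up j)).
  exact: path_up_self.
by move=> j l vj vl; rewrite minnC /minn; case: ifP.
Qed.

Lemma lowest_le v j : (1 <= j <= N)%N -> v \in path_up j -> (lowest v <= j)%N.
Proof.
move=> jN vj; have : j \in index_iota 1 N.+1 by rewrite mem_index_iota.
rewrite /lowest; elim: (index_iota _ _) => //= i s IH.
rewrite in_cons big_cons => /predU1P[<-|/IH h]; first by rewrite vj geq_minl.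
by case: ifP => // _; rewrite geq_min h orbT.
Qed.

Lemma lowest_ge1 v : (1 <= v)%N -> (1 <= lowest v)%N.
Proof.
move=> v1; rewrite /lowest big_nat_cond; apply: (big_rec (fun j => 1 <= j)%N) => //.
by move=> j l /andP[/andP[j1 _] _] l1; rewrite leq_min j1.
Qed.

Lemma path_up_interval v i : (1 <= v <= N)%N -> (1 <= i <= N)%N ->
  (v \in path_up i) = (lowest v <= i <= v)%N.
Proof.
move=> vN iN; apply/idP/idP => [vi|/andP[li iv]].
  by rewrite lowest_le//=; have := path_up_ge iN vi; lia.
apply: descendants_interval (lowest_path vN); last by lia.
by rewrite lowest_ge1//; lia.
Qed.

End Forest.

(** * Certificates of vertex algorithms *)

(** By strict triangularity the (a, b) entries of both products involve only entries of smaller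
    index sum, so the difference vanishes by induction on a + b. *)
Lemma lower_lyapunov_inj (R : realType) (n : nat) (C P Q : 'M[R]_n) :
    (forall k j : 'I_n, (k <= j)%N -> C k j = 0) ->
  P + P *m C^T + C *m P = Q + Q *m C^T + C *m Q -> P = Q.
Proof.
move=> Clow /eqP; rewrite -subr_eq0 !opprD.
rewrite addrACA [X in X + _]addrACA -mulmxBl -mulmxBr => /eqP PQ.
apply/eqP; rewrite -subr_eq0; apply/eqP; move: (P - Q) PQ => {P Q} P PE.
suff h (d : nat) : forall a b : 'I_n, (a + b < d)%N -> P a b = 0.
  by apply/matrixP => a b; rewrite mxE (h (a + b).+1).
elim: d => // d IH a b abd.
have : (P + P *m C^T + C *m P) a b = 0 by rewrite PE mxE.
rewrite !mxE [X in _ + X + _]big1 => [|c _]; last first.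
  rewrite [C^T _ _]mxE; have [bc|cb] := leqP b c; first by rewrite Clow// mulr0.
  by rewrite IH ?mul0r//; lia.
rewrite addr0 big1 ?addr0// => c _.
have [ac|ca] := leqP a c; first by rewrite Clow// mul0r.
by rewrite IH ?mulr0//; lia.
Qed.

Section Vertex.
Variables (R : realType) (n : nat) (H : 'M[R]_n).
Hypothesis hH : @optimal_vertex R n.+1 H.
Local Notation N := n.+1.
Local Notation Nr := (n.+1%:R : R).
Local Notation par := (@parent R N H).
Local Notation cert := (@Hcert R N H).

Let Hopt : @Hstar R N H. Proof. by case: hH. Qed.

Lemma vertex_trig : is_trig_mx H.
Proof. by case: Hopt. Qed.

Let Hbal := Hstar_balanced vertex_trig Hopt.

Lemma cert_gram (k j : nat) : (1 <= j < k)%N -> (k <= N)%N ->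
  cert k j = - (Nr * gram H (inord k.-1) (inord j.-1)).
Proof.
move=> jk kN; rewrite -Hcert_gram ?vertex_trig//; last by rewrite !inordK; lia.
by congr Hcert; rewrite inordK; lia.
Qed.

Lemma cert_ge0 (k j : nat) : (1 <= j < k)%N -> (k <= N)%N -> 0 <= cert k j.
Proof.
move=> jk kN; rewrite cert_gram// oppr_ge0 mulr_ge0_le0//.
by apply: (Hstar_gram vertex_trig Hopt); rewrite !inordK; lia.
Qed.

Lemma parentP j : (1 <= j < N)%N ->
  [/\ (j < par j <= N)%N, 0 < cert (par j) j
    & forall k, (j < k <= N)%N -> k != par j -> cert k j = 0].
Proof.
move=> jN; have [_ /(_ j jN)[k0 [[k0r k0p] k0u]]] := hH.
have -> : par j = k0.
  rewrite /parent; set s := [seq _ <- _ | _].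
  have : k0 \in s by rewrite mem_filter k0p mem_index_iota; lia.
  have : all (fun k => k0 == k) s.
    apply/allP => k; rewrite mem_filter mem_index_iota => /andP[kp kr].
    by apply/eqP/k0u; split=> //; lia.
  by case: s => //= h t /andP[/eqP].
split=> // k kr kk0; apply/eqP; rewrite eq_le cert_ge0 ?andbT; [|lia|lia].
rewrite leNgt; apply/negP => kp; case/eqP: kk0.
by apply/esym/k0u.
Qed.

Lemma parent_gt j : (1 <= j < N)%N -> (j < par j <= N)%N.
Proof. by case/parentP. Qed.

Lemma parent_last : par N = N.
Proof. by rewrite /parent /index_iota subnn. Qed.

(** The root has no arc; its weight 1 supplies the term e_N e_N^T added to the Laplacian, which
    makes N Gamma invertible. *)
Definition weight (v : 'I_N) : R :=
  if v == ord_max then 1 else cert (par v.+1) v.+1.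

Lemma ord_lt_max (v : 'I_N) : v != ord_max -> (1 <= v.+1 < N)%N.
Proof. by rewrite -val_eqE/=; have := ltn_ord v; lia. Qed.

Lemma weight_gt0 v : 0 < weight v.
Proof.
rewrite /weight; case: eqP => // /eqP vm.
by have [] := parentP (ord_lt_max vm).
Qed.

Definition arcmx : 'M[R]_N := \matrix_(a, v)
  ((a == v)%:R - ((v != ord_max) && (a.+1 == par v.+1))%:R).

Definition ancmx : 'M[R]_N :=
  \matrix_(i, v) (v.+1 \in (@path_to_top R N H i.+1))%:R.

Definition weightmx : 'M[R]_N := diag_mx (\row_v weight v).
Definition iweightmx : 'M[R]_N := diag_mx (\row_v (weight v)^-1).

Lemma sum_parent (v : 'I_N) (F : nat -> R) : v != ord_max ->
  \sum_(i < N) (i.+1 == par v.+1)%:R * F i.+1 = F (par v.+1).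
Proof.
move=> /ord_lt_max/parent_gt pv.
have pE : (inord (par v.+1).-1 : 'I_N).+1 = par v.+1 by rewrite inordK; lia.
rewrite (bigD1 (inord (par v.+1).-1))//= pE eqxx mul1r big1 ?addr0// => i ii.
case: eqP => [e|_]; last by rewrite mul0r.
by case/eqP: ii; apply/val_inj; rewrite /= inordK; lia.
Qed.

Lemma sum_eq (v : 'I_N) (F : 'I_N -> R) : \sum_i (i == v)%:R * F i = F v.
Proof.
rewrite (bigD1 v)//= eqxx mul1r big1 ?addr0// => i /negPf ->; exact: mul0r.
Qed.

(** The path from v and the path from its parent differ by v alone. *)
Lemma ancmx_arcmx : ancmx^T *m arcmx = 1%:M.
Proof.
apply/matrixP => u v; rewrite !mxE.
pose F (i : nat) : R := (u.+1 \in (@path_to_top R N H i))%:R.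
transitivity (\sum_i (i == v)%:R * F i.+1 -
    \sum_(i < N) ((v != ord_max) && (i.+1 == par v.+1))%:R * F i.+1).
  rewrite -sumrB; apply: eq_bigr => i _.
  by rewrite mulrC [arcmx _ _]mxE [ancmx^T _ _]mxE [ancmx _ _]mxE mulrBl.
rewrite (sum_eq v (fun i => F i.+1)) /F /path_to_top.
have vN : (1 <= v.+1 <= N)%N by have := ltn_ord v; lia.
have [->|vm] := eqVneq v ord_max.
  rewrite big1 ?subr0 => [|i _]; last by rewrite mul0r.
  by rewrite (path_up_last parent_last)// eqSS.
rewrite (sum_parent F vm) /F /path_to_top.
rewrite (path_up_cons parent_gt parent_last)// eqSS val_eqE.
case: eqP => [->|_]; last by rewrite subrr.
have pv := parent_gt (ord_lt_max vm).
case: (boolP (_ \in _)) => [/(path_up_ge parent_gt parent_last)|_]; last exact: subr0.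
by lia.
Qed.

Lemma ancmx_arcmx_tr : ancmx *m arcmx^T = 1%:M.
Proof. by rewrite -[LHS]trmxK trmx_mul trmxK (mulmx1C ancmx_arcmx) trmx1. Qed.

Lemma weightmxK : weightmx *m iweightmx = 1%:M.
Proof.
rewrite mulmx_diag -diag_const_mx; congr diag_mx; apply/rowP => v.
by rewrite !mxE divff// gt_eqF// weight_gt0.
Qed.

(** Off the diagonal both sides are minus the certificates, which vanish except on arcs; the
    diagonals agree because both matrices have row sums e_N. *)
Lemma gram_tree : Nr *: gram H = arcmx *m weightmx *m arcmx^T.
Proof.
set F := RHS.
pose p (a v : 'I_N) : R := ((v != ord_max) && (a.+1 == par v.+1))%:R.
have FE a b : F a b = \sum_v arcmx a v * weight v * arcmx b v.
  rewrite [LHS]mxE; apply: eq_bigr => v _; rewrite [arcmx^T _ _]mxE.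
  by rewrite mul_mx_diag [X in X * _]mxE [X in _ * X * _]mxE.
have off (a b : 'I_N) : (b < a)%N -> F a b = Nr * gram H a b.
  move=> ba; have ab : (a == b) = false by rewrite -val_eqE/= gtn_eqF.
  have bm : b != ord_max by rewrite -val_eqE/=; have := ltn_ord a; lia.
  have pba : p b a = 0.
    rewrite /p; case: eqP => //= am; case: eqP => // e.
    by have := parent_gt (ord_lt_max (introN eqP am)); lia.
  have pab v : p a v * p b v = 0.
    rewrite /p; case: eqP => /= _; rewrite ?mul0r//.
    case: eqP => [e|_]; rewrite ?mul0r//; case: eqP => [e'|_]; rewrite ?mulr0//.
    by exfalso; lia.
  rewrite FE (eq_bigr (fun v => (v == b)%:R * - (p a v * weight v) +
     (v == a)%:R * - (p b v * weight v))) => [|v _]; last first.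
    rewrite [arcmx _ _]mxE [arcmx _ _]mxE -/(p a v) -/(p b v) ![_ == v]eq_sym.
    have eab : (v == a)%:R * (v == b)%:R = 0 :> R.
      by case: eqP => [->|_]; rewrite ?ab ?mulr0 ?mul0r.
    transitivity ((v == a)%:R * (v == b)%:R * weight v + p a v * p b v * weight v +
      ((v == b)%:R * - (p a v * weight v) + (v == a)%:R * - (p b v * weight v))).
      ring.
    by rewrite eab pab !mul0r !add0r.
  rewrite big_split/= !sum_eq pba mul0r oppr0 addr0.
  have cab := Hcert_gram vertex_trig ba.
  have [_ _ c0] := parentP (ord_lt_max bm).
  rewrite /p bm/= /weight (negPf bm); case: eqP => [<-|/eqP e].
    by rewrite mul1r cab opprK.
  rewrite mul0r oppr0; apply: oppr_inj; rewrite -cab c0 ?oppr0//.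
  by rewrite ltnS ba ltn_ord.
have Fsym a b : F a b = F b a.
  by rewrite !FE; apply: eq_bigr => v _; ring.
have offd a b : a != b -> F a b = Nr * gram H a b.
  rewrite neq_ltn => /orP[|/off//]; rewrite Fsym gram_sym; exact: off.
have colsum v : \sum_b arcmx b v = (v == ord_max)%:R.
  under eq_bigr do rewrite mxE -[(_ == v)%:R]mulr1.
  rewrite sumrB (sum_eq v (fun=> 1)); have [->|vm] := eqVneq v ord_max.
    by rewrite big1 ?subr0.
  rewrite (eq_bigr (fun b : 'I_N => (b.+1 == par v.+1)%:R * 1)) => [|b _].
    by rewrite (sum_parent (fun=> 1) vm) subrr.
  by rewrite mulr1.
have rowsum a : \sum_b F a b = (a == ord_max)%:R.
  under eq_bigr do rewrite FE.
  rewrite exchange_big/=; under eq_bigr do rewrite -mulr_sumr colsum mulrC.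
  by rewrite sum_eq mxE eqxx/= subr0 /weight eqxx mulr1.
apply/matrixP => a b; rewrite mxE.
have [->|ab] := eqVneq a b; last by rewrite offd.
have gr : \sum_c Nr * gram H b c = (b == ord_max)%:R.
  by rewrite -mulr_sumr gram_rowsum// mulrCA mulfV ?mulr1 ?pnatr_eq0.
have := rowsum b; rewrite -gr.
rewrite (bigD1 b)//= [in RHS](bigD1 b)//=.
rewrite (eq_bigr (fun c => Nr * gram H b c)) => [/addIr->//|c cb].
by rewrite offd// eq_sym.
Qed.

Definition ancgram : 'M[R]_N := ancmx *m iweightmx *m ancmx^T.

Lemma ancgramE i j : ancgram i j = \sum_v ancmx i v * ancmx j v / weight v.
Proof.
rewrite mxE; apply: eq_bigr => v _.
rewrite [ancmx^T _ _]mxE mul_mx_diag [X in X * _]mxE [X in _ * X * _]mxE; ring.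
Qed.

Lemma ancgram_inv : ancgram *m (Nr *: gram H) = 1%:M.
Proof.
rewrite gram_tree /ancgram !mulmxA -(mulmxA _ ancmx^T) ancmx_arcmx mulmx1.
by rewrite -(mulmxA ancmx) (mulmx1C weightmxK) mulmx1 ancmx_arcmx_tr.
Qed.

(** Multiplying the equation for N Gamma on both sides by its inverse K gives the equation satisfied
    by N P, and that equation has only one solution. *)
Lemma pgram_prow_vertex : Nr *: pgram (prow H) = ancgram.
Proof.
pose C := stepmx H; pose A := Nr *: gram H; pose K := ancgram.
have KA : K *m A = 1%:M := ancgram_inv.
have AK : A *m K = 1%:M := mulmx1C KA.
have Nr0 : Nr != 0 by rewrite pnatr_eq0.
(* The row sums say N Gamma 1 = e_N, hence K e_N = 1. *)
have K1 : K *m delta_mx ord_max 0 = const_mx 1 :> 'cV_N.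
  have A1 : A *m const_mx 1 = delta_mx ord_max 0 :> 'cV_N.
    apply/matrixP => a b; rewrite [LHS]mxE (eq_bigr (fun c => Nr * gram H a c)) => [|c _].
      by rewrite -mulr_sumr gram_rowsum// mxE ord1 andbT mulrCA mulfV// mulr1.
    by rewrite [const_mx _ _ _]mxE mulr1 mxE.
  by rewrite -A1 mulmxA KA mul1mx.
have Ktr : K^T = K.
  by apply/matrixP => i j; rewrite mxE !ancgramE; apply: eq_bigr => v _; ring.
have AL : A + A *m C + C^T *m A = Nr *: delta_mx ord_max ord_max.
  by rewrite -(gram_lyapunov vertex_trig) !scalerDr scalemxAl scalemxAr.
have KL : K + K *m C^T + C *m K = Nr *: const_mx 1.
  have -> : Nr *: const_mx 1 = K *m (Nr *: delta_mx ord_max ord_max) *m K.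
    have -> : K *m (Nr *: delta_mx ord_max ord_max) *m K =
        Nr *: (K *m delta_mx ord_max 0 *m (delta_mx (0 : 'I_1) ord_max *m K)).
      by rewrite -scalemxAr -scalemxAl !mulmxA -(mulmxA K) mul_delta_mx.
    rewrite K1.
    have -> : delta_mx 0 ord_max *m K = const_mx 1 :> 'rV_N.
      by rewrite -[LHS]trmxK trmx_mul Ktr trmx_delta K1 trmx_const.
    by congr (_ *: _); apply/matrixP => i j; rewrite !mxE big_ord1 !mxE mulr1.
  have T2 : K *m (A *m C) *m K = C *m K by rewrite mulmxA KA mul1mx.
  have T3 : K *m (C^T *m A) *m K = K *m C^T by rewrite -!mulmxA AK mulmx1.
  by rewrite -AL !mulmxDr !mulmxDl T2 T3 KA mul1mx -!addrA (addrC (C *m K)).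
apply: (lower_lyapunov_inj (C := C)).
  by move=> k j; exact: stepmx_lower vertex_trig _ _.
rewrite -[RHS]/(K + K *m C^T + C *m K) KL -(pgram_prow_lyapunov vertex_trig).
by rewrite !scalerDr scalemxAl scalemxAr.
Qed.

Lemma gram_dual_vertex (i j : 'I_N) :
  Nr * gram (@Hdual R N H) (rev_ord i) (rev_ord j) =
  \sum_v backdiff (ancmx^~ v) i * backdiff (ancmx^~ v) j / weight v.
Proof.
rewrite gram_dual ?vertex_trig//.
have PE a b : pgram (prow H) a b = Nr^-1 * \sum_v ancmx a v * ancmx b v / weight v.
  by rewrite -ancgramE -pgram_prow_vertex mxE mulrA mulVf ?mul1r// pnatr_eq0.
have Nr0 : Nr != 0 by rewrite pnatr_eq0.
rewrite /backdiff; case: unlift => [i'|]; case: unlift => [j'|]; rewrite ?subr0 !PE;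
  rewrite -?mulrBr mulrA mulfV// mul1r -?sumrB -?sumrB -?sumrB;
  apply: eq_bigr => v _; rewrite ?subr0; ring.
Qed.

End Vertex.

(** * The dual of a vertex algorithm *)

Section Duality.
Variables (R : realType) (n : nat) (H : 'M[R]_n).
Hypothesis hH : @optimal_vertex R n.+1 H.
Local Notation N := n.+1.
Local Notation Nr := (n.+1%:R : R).
Local Notation par := (@parent R N H).
Local Notation cert := (@Hcert R N H).
Local Notation HA := (@Hdual R N H).
Local Notation low := (@smallest_descendant R N H).

Let Htrig := vertex_trig hH.
Let pgt := parent_gt hH.
Let plast := parent_last H.
Let gramA_tree := gram_dual_vertex hH.

Lemma sum_backdiff_itv (f : 'I_N -> R) (a b : 'I_N) : (a <= b)%N ->
  \sum_(i < N | (a < i <= b)%N) backdiff f i = f b - f a.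
Proof.
move=> ab; rewrite -(sum_backdiff f b) -(sum_backdiff f a).
apply/eqP; rewrite eq_sym subr_eq addrC; apply/eqP.
rewrite (bigID (fun i : 'I_N => (i <= a)%N))/=.
by congr (_ + _); apply: eq_bigl => i; lia.
Qed.

(** For a crossing of the arcs of j1 and j2, the dual Gram entries are summed over the rectangle j
    <= j1, j2 < i <= k(j1). Optimality of the dual makes the sum nonpositive, while telescoping in
    both directions makes it positive. *)
Lemma dual_noncrossing : @Hstar R N HA -> noncrossing (@arc_diagram R N H).
Proof.
move=> hA [_ [_ [/mapP[j1 j1N ->] /mapP[j2 j2N ->]]]] /=.
move: j1N j2N; rewrite !mem_index_iota => j1N j2N.
move=> /andP[/andP[j12 j2p] pp].
have p1 := pgt j1N; have p2 := pgt j2N.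
pose J : 'I_N := inord j1.-1; pose I : 'I_N := inord j2.-1.
pose I' : 'I_N := inord (par j1).-1.
have JE : J.+1 = j1 by rewrite inordK; lia.
have IE : I.+1 = j2 by rewrite inordK; lia.
have I'E : I'.+1 = par j1 by rewrite inordK; lia.
have neg (i j : 'I_N) : (j < i)%N -> gram HA (rev_ord i) (rev_ord j) <= 0.
  move=> ji; rewrite gram_sym; apply: (Hstar_gram (Hdual_trig Htrig) hA) => /=.
  by have := ltn_ord i; lia.
pose S := \sum_(j < N | (j <= J)%N) \sum_(i < N | (I < i <= I')%N)
  Nr * gram HA (rev_ord i) (rev_ord j).
have S_le0 : S <= 0.
  rewrite -oppr_ge0 -sumrN; apply: sumr_ge0 => j jJ; rewrite -sumrN.
  apply: sumr_ge0 => i iI; rewrite oppr_ge0 mulr_ge0_le0// neg//; lia.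
have SE : S = \sum_v (ancmx H I' v - ancmx H I v) * ancmx H J v / weight H v.
  rewrite /S; under eq_bigr do under eq_bigr do rewrite gramA_tree.
  under eq_bigr do rewrite exchange_big/=.
  rewrite exchange_big/=; apply: eq_bigr => v _.
  have II' : (I <= I')%N by lia.
  transitivity (\sum_(j < N | (j <= J)%N) (ancmx H I' v - ancmx H I v) *
      (backdiff ((ancmx H)^~ v) j / weight H v)).
    apply: eq_bigr => j _; rewrite -(sum_backdiff_itv ((ancmx H)^~ v) II') mulr_suml.
    by apply: eq_bigr => i _; rewrite mulrA.
  by rewrite -mulr_sumr -mulr_suml (sum_backdiff ((ancmx H)^~ v)) mulrA.
have pathE (i : 'I_N) u : (i.+1 < N)%N -> ancmx H i u =
    ((u.+1 == i.+1) || (u.+1 \in traject par (par i.+1) N))%:R.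
  by move=> iN; rewrite mxE /path_to_top (path_up_cons pgt plast)//; lia.
have rng (a : 'I_N) : (1 <= a.+1 <= N)%N by have := ltn_ord a; lia.
(* An ancestor of j1 other than j1 is an ancestor of k(j1), so the first factor is nonnegative; j1
   itself is an ancestor of neither j2 nor k(j1). *)
have term_ge0 v : 0 <= (ancmx H I' v - ancmx H I v) * ancmx H J v / weight H v.
  rewrite divr_ge0 ?(ltW (weight_gt0 hH v))// (pathE J) ?JE; last by lia.
  have [vj|vj] := eqVneq v.+1 j1.
    have -> : ancmx H I' v = 0.
      rewrite mxE; case: (boolP (_ \in _)) => // /(path_up_ge pgt plast (rng I')).
      by rewrite I'E vj; lia.
    have -> : ancmx H I v = 0.
      rewrite mxE; case: (boolP (_ \in _)) => // /(path_up_ge pgt plast (rng I)).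
      by rewrite IE vj; lia.
    by rewrite subrr mul0r.
  rewrite /= -I'E; rewrite !mxE /path_to_top; case: (v.+1 \in _); last by rewrite mulr0.
  by rewrite mulr1 subr_ge0; case: (v.+1 \in _).
have : 0 < S.
  rewrite SE (bigD1 I')//= ltr_pwDl ?sumr_ge0//.
  rewrite divr_gt0 ?weight_gt0// (pathE J) ?JE; last by lia.
  (* The node k(j1) lies strictly between j2 and k(j2), so the path from j2 skips it and its term is
     positive. *)
  have -> : ancmx H I I' = 0.
    rewrite (pathE I) ?IE; last by lia.
    rewrite I'E; case: eqP => [|_ /=]; first by lia.
    have p2N : (1 <= par j2 <= N)%N by lia.
    by case: (boolP (_ \in _)) => // /(path_up_ge pgt plast p2N); lia.
  have self : I'.+1 \in traject par (par j1) N.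
    by rewrite I'E (path_up_self pgt plast)//; lia.
  rewrite self orbT subr0 mulr1 mxE /path_to_top.
  by rewrite (path_up_self pgt plast (rng I')).
by rewrite ltNge S_le0.
Qed.

Hypothesis nc : noncrossing (@arc_diagram R N H).

Lemma no_crossing a b : (1 <= a)%N -> (a < b)%N -> (b < par a)%N ->
  (par a < par b)%N -> (b < N)%N -> False.
Proof.
move=> a1 ab bp pp bN; apply: nc; exists (par a, a), (par b, b).
rewrite ab bp pp; split=> //; apply/mapP; first exists a => //.
  by rewrite mem_index_iota; lia.
by exists b => //; rewrite mem_index_iota; lia.
Qed.

Lemma low_range (v : nat) : (1 <= v <= N)%N -> (1 <= low v <= v)%N.
Proof.
move=> vN; rewrite (lowest_ge1 N par)/=; last by lia.
exact: (lowest_le vN (path_up_self pgt plast vN)).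
Qed.

(** Without crossings the descendants of a node form an interval, whose indicator rises at its
    smallest descendant and drops just after the node itself. *)
Lemma backdiff_ancmx (v i : 'I_N) : backdiff ((ancmx H)^~ v) i =
  (i.+1 == low v.+1)%:R - (i == v.+1 :> nat)%:R.
Proof.
have lv : (1 <= low v.+1 <= v.+1)%N by apply: low_range; have := ltn_ord v; lia.
have aE (a : 'I_N) : ancmx H a v = (low v.+1 <= a.+1 <= v.+1)%:R.
  rewrite mxE /path_to_top (path_up_interval pgt plast no_crossing)//.
    by have := ltn_ord v; lia.
  by have := ltn_ord a; lia.
have subb (b c d e : bool) : (b + e = d + c)%N -> b%:R - c%:R = d%:R - e%:R :> R.
  move=> h; apply/eqP; rewrite subr_eq addrAC eq_sym subr_eq -!natrD.
  by rewrite h.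
case: (unliftP ord0 i) => [i'|] ->.
  rewrite backdiffS !aE; apply: subb; rewrite /= /bump/= !add1n; lia.
rewrite backdiff0 aE -[LHS]subr0 -[0 in LHS]/(false%:R); apply: subb => /=; lia.
Qed.

(** Since j < i, a node contributes only if its indicator drops at i and rises at j. The drop at i
    determines the node, so at most one term survives. *)
Lemma gram_dual_noncrossing (i j : 'I_N) : (j < i)%N ->
  - (Nr * gram HA (rev_ord j) (rev_ord i)) =
  if j.+1 == low i then (cert (par i) i)^-1 else 0.
Proof.
move=> ji; rewrite gram_sym gramA_tree.
(* With ordinals shifted by one, this is the node numbered [i], the predecessor of the node numbered
   [i.+1]. *)
pose v : 'I_N := inord i.-1.
have vE : v.+1 = i by rewrite inordK; have := ltn_ord i; lia.
have vm : v != ord_max by rewrite -val_eqE/=; have := ltn_ord i; lia.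
have lr (u : 'I_N) : (1 <= low u.+1 <= u.+1)%N.
  by apply: low_range; have := ltn_ord u; lia.
rewrite (bigD1 v)//= big1 ?addr0 => [|u uv].
  rewrite !backdiff_ancmx vE eqxx; have := lr v; rewrite vE => lv.
  rewrite (_ : i.+1 == low i = false); last by apply/negbTE; lia.
  rewrite (_ : j == i :> nat = false); last by apply/negbTE; lia.
  rewrite subr0 sub0r mulN1r mulNr opprK /weight (negPf vm) vE.
  by case: ifP; rewrite (mul1r, mul0r).
have iu : (i == u.+1 :> nat) = false.
  apply/negP => /eqP iu; case/eqP: uv.
  by apply/val_inj/succn_inj; rewrite vE iu.
rewrite !backdiff_ancmx iu subr0; case: eqP => [il|_]; last by rewrite !mul0r.
have := lr u => lu.
rewrite (_ : j.+1 == low u.+1 = false); last by apply/negbTE; lia.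
rewrite (_ : j == u.+1 :> nat = false); last by apply/negbTE; lia.
by rewrite subr0 mulr0 mul0r.
Qed.

Lemma Hcert_dual_noncrossing (i j : nat) :
  (1 <= j)%N -> (j < i)%N -> (i <= N)%N ->
  @Hcert R N HA (N - j + 1) (N - i + 1) =
  if j == low i.-1 then (cert (par i.-1) i.-1)^-1 else 0.
Proof.
move=> j1 ji iN; pose i' : 'I_N := inord i.-1; pose j' : 'I_N := inord j.-1.
have iE : i' = i.-1 :> nat by rewrite inordK; lia.
have jE : j' = j.-1 :> nat by rewrite inordK; lia.
have := @gram_dual_noncrossing i' j'; rewrite iE jE prednK// => <-; last by lia.
rewrite -Hcert_gram ?Hdual_trig//=; last by rewrite iE jE; lia.
by congr Hcert; rewrite ?iE ?jE; lia.
Qed.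

Lemma dual_optimal : @optimal_vertex R N HA.
Proof.
have HAtrig := Hdual_trig Htrig.
have certP (v : nat) : (1 <= v < N)%N -> 0 < cert (par v) v by case/(parentP hH).
split.
  apply: (@Hstar_of_gram R n HA HAtrig).
    exact: balanced_dual Htrig (Hstar_balanced Htrig hH.1).
  move=> a b ba; have an := ltn_ord a.
  have ra : (rev_ord a < rev_ord b)%N by rewrite /=; lia.
  have := gram_dual_noncrossing ra; rewrite !rev_ordK => h.
  have N0 : 0 < Nr by rewrite ltr0n.
  rewrite -(pmulr_rle0 _ N0) -oppr_ge0 h; case: ifP => // _.
  by rewrite invr_ge0 ltW// certP//=; lia.
(* Reversal sends [j] to [i], and the certificate formula is nonzero only at [l]; the parent of [j]
   in the dual is therefore the reversal of [l]. *)
move=> j jN; pose i := (N - j + 1)%N; pose l := low i.-1.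
have lr : (1 <= l <= i.-1)%N by apply: low_range; rewrite /i; lia.
have cE k : (j < k <= N)%N -> @Hcert R N HA k j =
    if (N - k + 1)%N == l then (cert (par i.-1) i.-1)^-1 else 0.
  move=> kN; rewrite -Hcert_dual_noncrossing; rewrite /i; [|lia..].
  by congr Hcert; lia.
exists (N - l + 1)%N; split.
  have kN : (j < N - l + 1 <= N)%N by move: lr; rewrite /i; lia.
  split=> //; rewrite cE// (_ : (N - (N - l + 1) + 1)%N = l); last by move: lr; rewrite /i; lia.
  by rewrite eqxx invr_gt0 certP//; rewrite /i; lia.
move=> k [kN]; rewrite cE//; case: eqP => [<- _|_]; last by rewrite ltxx.
by lia.
Qed.

End Duality.

Theorem theorem4 (R : realType) (N : nat) (hN : (1 <= N)%N)
    (H : 'M[R]_N.-1) (hH : optimal_vertex H) :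
  (Hstar (Hdual H) <-> noncrossing (arc_diagram H)) /\
  (noncrossing (arc_diagram H) ->
    optimal_vertex (Hdual H) /\
    forall i j : nat, (1 <= j)%N -> (j < i)%N -> (i <= N)%N ->
      Hcert (Hdual H) (N - j + 1)%N (N - i + 1)%N =
        if j == smallest_descendant H i.-1
        then (Hcert H (parent H i.-1) i.-1)^-1
        else 0).
Proof.
case: N hN H hH => // n _ H hH; split; first split.
- exact: dual_noncrossing.
- by move=> nc; case: (dual_optimal hH nc).
- move=> nc; split; first exact: dual_optimal.
  by move=> i j; exact: Hcert_dual_noncrossing.
Qed.
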